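(* Assume that the domain $\Omega$ is such that there is a constant $c$ for which, for every $f\in\mathbf{L}^2(\Omega)$, the solution $(\psi,\theta)\in\mathbf{H}^1_0(\Omega)\times L^2_{\int=0}(\Omega)$ of the Stokes problem $$-\Delta\psi+\nabla\theta=f \ \text{ in }\Omega,\qquad \nabla\cdot\psi=0\ \text{ in }\Omega,\qquad \psi=0\ \text{ on }\partial\Omega,$$ satisfies $\|\psi\|_{\mathbf{H}^2}+\|\theta\|_{H^1}\le c\|f\|_{\mathbf{L}^2}$. Suppose that the LBB condition holds: there is a constant $c>0$ independent of $h$ such that $$c\,\|q_h\|_{L^2}\le\sup_{0\neq v_h\in\mathbf{X}_h}\frac{\int_\Omega(\nabla\cdot v_h)\,q_h}{\|v_h\|_{\mathbf{H}^1}}\quad\text{for all } q_h\in M_h.$$ Then for each $h$ there is a Fortin projection $\mathcal{F}_h:\mathbf{H}^1_0(\Omega)\to\mathbf{X}_h$ satisfying, with a constant $c'$ independent of $h$, $$\|v-\mathcal{F}_hv\|_{\mathbf{L}^2}\le c'\,h\,\|v\|_{\mathbf{H}^1}\quad\text{for all } v\in\mathbf{H}^1_0(\Omega).$$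
   Context: $\Omega\subset\mathbb{R}^d$, $d\in\{2,3\}$, is a bounded open domain with Lipschitz boundary. Bold symbols denote spaces of $\mathbb{R}^d$-valued functions: $\mathbf{L}^2(\Omega)=L^2(\Omega)^d$, $\mathbf{H}^k=H^k(\Omega)^d$, $\mathbf{H}^1_0(\Omega)=H^1_0(\Omega)^d$. $L^2_{\int=0}(\Omega)$ is the set of functions in $L^2(\Omega)$ with mean zero. $\{\mathcal{T}_h\}_h$ is a family of conforming, shape-regular and quasi-uniform triangulations of $\Omega$ with mesh size $h>0$. $\mathbf{X}_h\subset\mathbf{H}^1_0(\Omega)$ and $M_h\subset L^2_{\int=0}(\Omega)\cap H^1(\Omega)$ are finite dimensional spaces constructed on $\mathcal{T}_h$ (for instance by finite elements). Standing assumptions, with constants $c$ independent of $h$: (i) $\|v_h\|_{\mathbf{H}^1}\le c h^{-1}\|v_h\|_{\mathbf{L}^2}$ for all $v_h\in\mathbf{X}_h$, and $\|q_h\|_{H^1}\le c h^{-1}\|q_h\|_{L^2}$ for all $q_h\in M_h$; (ii) there is an operator (the Scott-Zhang interpolation operator) $\mathcal{C}_h:\mathbf{H}^1_0(\Omega)\to\mathbf{X}_h$ with $\|v-\mathcal{C}_hv\|_{\mathbf{L}^2}+h\|\mathcal{C}_hv\|_{\mathbf{H}^1}\le c h\|v\|_{\mathbf{H}^1}$ for all $v\in\mathbf{H}^1_0(\Omega)$, and $\|v-\mathcal{C}_hv\|_{\mathbf{H}^1}\le c h\|v\|_{\mathbf{H}^2}$ for all $v\in\mathbf{H}^1_0(\Omega)\cap\mathbf{H}^2$;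 (iii) there is an analogous Scott-Zhang interpolation operator $\mathcal{I}_h:L^2_{\int=0}(\Omega)\to M_h$ onto the pressure space with similar stability and approximation properties, in particular $\|q-\mathcal{I}_hq\|_{L^2}+h\|\mathcal{I}_hq\|_{H^1}\le c h\|q\|_{H^1}$ for all $q\in L^2_{\int=0}(\Omega)\cap H^1(\Omega)$. Definition: an operator $\mathcal{F}_h:\mathbf{H}^1_0(\Omega)\to\mathbf{X}_h$ is called a Fortin projection (Fortin operator) if $\mathcal{F}_h^2=\mathcal{F}_h$ and $\int_\Omega\nabla\cdot(v-\mathcal{F}_hv)\,q_h=0$ for all $v\in\mathbf{H}^1_0(\Omega)$ and all $q_h\in M_h$. *)

(* Defs.v *)
From HB Require Import structures.
From mathcomp Require Import all_boot all_order all_algebra.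
From mathcomp Require Import all_classical all_reals all_analysis.

Set Implicit Arguments.
Unset Strict Implicit.
Unset Printing Implicit Defensive.

Import Order.TTheory GRing.Theory Num.Theory.
Import numFieldNormedType.Exports.

Local Open Scope classical_set_scope.
Local Open Scope ring_scope.

(* The product sigma-algebra (equivalently, the Borel sigma-algebra) on
   'rV[R]_n: it is generated by the coordinate maps. *)
Definition rV_display : measure_display. Proof. exact. Qed.

Section measurable_rV.
Variables (R : realType) (n : nat).

Let coord (i : 'I_n) (v : 'rV[R]_n) : measurableTypeR R := v ord0 i.

Let rV_set0 : g_sigma_preimage coord set0.
Proof. exact: sigma_algebra0. Qed.

Let rV_setC A : g_sigma_preimage coord A -> g_sigma_preimage coord (~` A).
Proof. exact: sigma_algebraC. Qed.

Let rV_bigcup (F : (set 'rV[R]_n)^nat) :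
  (forall i, g_sigma_preimage coord (F i)) ->
  g_sigma_preimage coord (\bigcup_i (F i)).
Proof. exact: sigma_algebra_bigcup. Qed.

HB.instance Definition _ := @isMeasurable.Build rV_display
  'rV[R]_n (g_sigma_preimage coord) rV_set0 rV_setC rV_bigcup.

End measurable_rV.

Section lebesgue_rV.
Variable R : realType.

Lemma measurable_coord n (i : 'I_n) :
  measurable_fun [set: 'rV[R]_n]
    ((fun v => v ord0 i) : 'rV[R]_n -> measurableTypeR R).
Proof.
move=> _ Y mY; rewrite setTI; apply: sub_sigma_algebra => /=.
rewrite -bigcup_seq/=; exists i => /=; first by rewrite mem_index_enum.
by exists Y => //; rewrite setTI.
Qed.

Lemma measurable_fun_rV d (T : measurableType d) n (f : T -> 'rV[R]_n) :
  (forall i, measurable_fun [set: T]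
    ((fun x => f x ord0 i) : T -> measurableTypeR R)) ->
  measurable_fun [set: T] f.
Proof.
move=> mf _ A; rewrite setTI => mA.
pose F := [set B : set 'rV[R]_n | measurable (f @^-1` B)].
suff : (@measurable _ 'rV[R]_n) `<=` F by exact.
apply: smallest_sub; first split => /=.
- by rewrite /F /= preimage_set0.
- by move=> B mB; rewrite /F /= setTD preimage_setC; exact: measurableC.
- move=> G mG; rewrite /F /= preimage_bigcup.
  by apply: bigcup_measurable => k _; exact: mG.
move=> B; rewrite -bigcup_seq => -[/= i _ [C mC <-]].
rewrite /F /= setTI.
by rewrite -[X in measurable X]setTI; exact: (mf i).
Qed.

Definition consrV n (p : measurableTypeR R * 'rV[R]_n) : 'rV[R]_n.+1 :=
  row_mx (const_mx p.1 : 'rV_1) p.2.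

Lemma measurable_consrV n : measurable_fun [set: _] (@consrV n).
Proof.
apply: measurable_fun_rV => i.
case: (@split_ordP 1 n i) => j ->.
  rewrite (_ : (fun _ => _) = fst); first exact: measurable_fst.
  by apply/funext => p; rewrite [LHS](@row_mxEl R 1 1 n) mxE.
rewrite (_ : (fun _ => _) =
    (fun v : 'rV[R]_n => v ord0 j : measurableTypeR R) \o snd).
  by apply: measurableT_comp; [exact: measurable_coord|exact: measurable_snd].
by apply/funext => p; rewrite [LHS](@row_mxEr R 1 1 n).
Qed.

Section lebesgue_cons.
Variables (n : nat) (mu : {sigma_finite_measure set 'rV[R]_n -> \bar R}).

Definition lebesgue_cons : set 'rV[R]_n.+1 -> \bar R :=
  pushforward (@lebesgue_measure R \x mu)%E (@consrV n).

Let nu := measure_function_pushforward__canonical__measure_function_Measure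
  (@lebesgue_measure R \x mu)%E (@measurable_consrV n).

Let lebesgue_cons0 : lebesgue_cons set0 = 0%E.
Proof. exact: (measure0 nu). Qed.

Let lebesgue_cons_ge0 A : (0 <= lebesgue_cons A)%E.
Proof. exact: (measure_ge0 nu). Qed.

Let lebesgue_cons_sigma_additive : semi_sigma_additive lebesgue_cons.
Proof. exact: (@measure_semi_sigma_additive _ _ _ nu). Qed.

HB.instance Definition _ := isMeasure.Build _ _ _ lebesgue_cons
  lebesgue_cons0 lebesgue_cons_ge0 lebesgue_cons_sigma_additive.

Let lebesgue_cons_sigma_finite : sigma_finite setT lebesgue_cons.
Proof.
have /sigma_finiteP[G [GT ndG Goo]] := sigma_finiteT (@lebesgue_measure R).
have /sigma_finiteP[K [KT ndK Koo]] := sigma_finiteT mu.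
pose F k := G k `*` K k.
have mF k : measurable (F k).
  by have [? _] := Goo k; have [? _] := Koo k; exact: measurableX.
pose un (v : 'rV[R]_n.+1) : measurableTypeR R * 'rV[R]_n :=
  (v ord0 ord0, rsubmx (v : 'rV_(1 + n))).
have munF k : measurable (un @^-1` F k).
  rewrite -[X in measurable X]setTI.
  apply: (_ : measurable_fun setT un) => //.
  apply: measurable_fun_pair; first exact: measurable_coord.
  apply: measurable_fun_rV => j.
  rewrite (_ : (fun _ => _) = (fun v : 'rV[R]_n.+1 =>
      v ord0 (rshift 1 j) : measurableTypeR R)); first exact: measurable_coord.
  by apply/funext => v; rewrite !mxE.
exists (fun k => un @^-1` F k).
  apply/seteqP; split => // v _.
  have : setT (un v).1 by [].
  have : setT (un v).2 by [].
  rewrite GT KT => -[b _ Kb] [a _ Ga]; exists (maxn a b) => //; split.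
    by move: Ga; exact/subsetPset/ndG/leq_maxl.
  by move: Kb; exact/subsetPset/ndK/leq_maxr.
move=> k; split=> //.
have unK p : un (consrV p) = p.
  case: p => x v; rewrite /un /consrV /=; congr pair.
    have -> : (ord0 : 'I_n.+1) = lshift n (ord0 : 'I_1) by exact/val_inj.
    by rewrite (@row_mxEl R 1 1 n) mxE.
  exact: row_mxKr.
rewrite /lebesgue_cons /pushforward.
rewrite (_ : consrV (n:=n) @^-1` _ = F k); last first.
  by apply/seteqP; split => p; rewrite /= unK.
have [mG Gk] := Goo k; have [mK Kk] := Koo k.
by rewrite product_measure1E// lte_mul_pinfty// ge0_fin_numE.
Qed.

HB.instance Definition _ := Measure_isSigmaFinite.Build _ _ _ lebesgue_cons
  lebesgue_cons_sigma_finite.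

End lebesgue_cons.

(* Lebesgue measure on R^n, as the n-fold product of Lebesgue measure on R. *)
Fixpoint lebesgue_rV (n : nat) : {sigma_finite_measure set 'rV[R]_n -> \bar R} :=
  match n with
  | 0 => dirac (0 : 'rV[R]_0)
  | n'.+1 => lebesgue_cons (lebesgue_rV n')
  end.

End lebesgue_rV.

Notation vfield R d := ('I_d -> 'rV[R]_d -> R) (only parsing).

Section sobolev.
Variables (R : realType) (d : nat) (Om : set 'rV[R]_d).
Implicit Types (u g phi q : 'rV[R]_d -> R) (v w f : vfield R d).

Local Notation mu := (lebesgue_rV R d).

Definition pderiv (i : 'I_d) phi : 'rV[R]_d -> R :=
  fun x => 'D_(delta_mx ord0 i) phi x.

Definition smooth phi :=
  forall (s : seq 'I_d) x, differentiable (foldr pderiv phi s) x.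

(* C_c^infinity(Om) *)
Definition test_function phi :=
  [/\ smooth phi, compact (closure [set x | phi x != 0]) &
      closure [set x | phi x != 0] `<=` Om].

(* Elements of the Lebesgue and Sobolev spaces are represented by functions
   defined on the whole space, of which only the values on Om matter, and
   identified when they are equal almost everywhere on Om. *)
Definition eq_on u g := ae_eq mu Om u g.

Definition L2 u :=
  measurable_fun Om u /\ (\int[mu]_(x in Om) ((u x) ^+ 2)%:E < +oo)%E.

Definition L2_mean0 q := L2 q /\ \int[mu]_(x in Om) q x = 0.

Definition weak_pderiv (i : 'I_d) u g := forall phi, test_function phi ->
  \int[mu]_(x in Om) (u x * pderiv i phi x) =
  - \int[mu]_(x in Om) (g x * phi x).

(* The weak partial derivative in L^2 (a representative of it), and 0 if there
   is none. *)
Definition wpd (i : 'I_d) u : 'rV[R]_d -> R :=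
  xget 0 [set g | L2 g /\ weak_pderiv i u g].

Fixpoint sobolev (k : nat) u : Prop :=
  match k with
  | 0 => L2 u
  | k'.+1 => L2 u /\ forall i, exists2 g, sobolev k' g & weak_pderiv i u g
  end.

(* For k = 2 every second order derivative d_i d_j is counted, i.e. the Hessian
   enters through its Frobenius norm. *)
Fixpoint sqnorm (k : nat) u : R :=
  \int[mu]_(x in Om) (u x ^+ 2) +
  match k with
  | 0 => 0
  | k'.+1 => \sum_(i < d) sqnorm k' (wpd i u)
  end.

Definition Hnorm (k : nat) u : R := Num.sqrt (sqnorm k u).

(* H^1_0 is the closure of the test functions in H^1. *)
Definition H10 u := sobolev 1 u /\
  forall eps : R, 0 < eps -> exists2 phi, test_function phi &
    Hnorm 1 (u - phi) < eps.

Definition veq v w := forall i, eq_on (v i) (w i).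

Definition vL2 v := forall i, L2 (v i).

Definition vsobolev (k : nat) v := forall i, sobolev k (v i).

Definition vH10 v := forall i, H10 (v i).

Definition vHnorm (k : nat) v : R := Num.sqrt (\sum_(i < d) sqnorm k (v i)).

Definition divergence v : 'rV[R]_d -> R := fun x => \sum_(i < d) wpd i (v i) x.

(* The momentum equation - Delta psi + grad theta = f holds in the sense of
   distributions on Om; the boundary condition is psi \in H^1_0. *)
Definition stokes_solution f psi theta :=
  [/\ vH10 psi, L2_mean0 theta,
      forall (i : 'I_d) phi, test_function phi ->
        \int[mu]_(x in Om)
           (\sum_(j < d) wpd j (psi i) x * pderiv j phi x) -
        \int[mu]_(x in Om) (theta x * pderiv i phi x) =
        \int[mu]_(x in Om) (f i x * phi x)
    & eq_on (divergence psi) 0].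

Definition stokes_regularity := exists c : R, forall f, vL2 f ->
  (exists psi theta, stokes_solution f psi theta) /\
  forall psi theta, stokes_solution f psi theta ->
    [/\ vsobolev 2 psi, sobolev 1 theta &
        vHnorm 2 psi + Hnorm 1 theta <= c * vHnorm 0 f].

(* An operator from the space S to the space X, on classes modulo e. *)
Definition operator_on T (e : T -> T -> Prop) (S X : set T) (F : T -> T) :=
  (forall v : T, S v -> X (F v)) /\
  (forall v w : T, S v -> S w -> e v w -> e (F v) (F w)).

Definition linear_operator_on (T : lmodType R) (e : T -> T -> Prop)
    (S X : set T) (F : T -> T) :=
  operator_on e S X F /\
  forall (a : R) (v w : T), S v -> S w -> e (F (a *: v + w)) (a *: F v + F w).

(* X is the span, in S modulo e, of finitely many elements of S. *)
Definition findim_subspace (T : lmodType R) (e : T -> T -> Prop)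
    (S X : set T) :=
  exists n (b : 'I_n -> T), (forall i, S (b i)) /\
    forall v : T, X v <-> S v /\ exists c : 'I_n -> R, e v (\sum_i c i *: b i).

Definition fortin_projection (X : set (vfield R d)) (M : set ('rV[R]_d -> R))
    (F : vfield R d -> vfield R d) :=
  [/\ linear_operator_on veq vH10 X F,
      forall v, vH10 v -> veq (F (F v)) (F v)
    & forall v q, vH10 v -> M q ->
        \int[mu]_(x in Om) (divergence (v - F v) x * q x) = 0].

(* The set is bounded above by the Cauchy-Schwarz inequality, so the supremum
   is the actual one; it is 0 if X is trivial. *)
Definition LBB_sup (X : set (vfield R d)) q : R :=
  sup [set \int[mu]_(x in Om) (divergence v x * q x) / vHnorm 1 v |
       v in [set v | X v /\ ~ veq v 0]].

End sobolev.

Section geometry.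
Variables (R : realType) (d : nat).
Implicit Types (x y z e : 'rV[R]_d) (Om K : set 'rV[R]_d).

Definition dotp x y : R := \sum_(i < d) x ord0 i * y ord0 i.

(* The norm `|x| of the library on 'rV[R]_d is the sup norm. *)
Definition enorm x : R := Num.sqrt (dotp x x).

(* Near every boundary point, Om is the strict epigraph, in the direction of a
   unit vector e, of a Lipschitz function g of the component orthogonal to e. *)
Definition lipschitz_boundary Om :=
  forall x, closure Om x -> ~ Om x ->
  exists (r L : R) e (g : 'rV[R]_d -> R),
    [/\ 0 < r, dotp e e = 1,
        forall y z, `|g y - g z| <= L * enorm (y - z)
      & forall y, enorm (y - x) < r ->
          (Om y <-> g (y - dotp y e *: e) < dotp y e)].

Definition lipschitz_domain Om :=
  [/\ open Om, connected Om, Om !=set0, bounded_set Om & lipschitz_boundary Om].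

(* A simplex is given by the matrix whose rows are its vertices; face A S is
   the convex hull of the vertices with index in S. *)
Definition face (A : 'M[R]_(d.+1, d)) (S : {set 'I_d.+1}) : set 'rV[R]_d :=
  [set x | exists w : 'rV[R]_d.+1,
    [/\ forall i, 0 <= w ord0 i, forall i, i \notin S -> w ord0 i = 0,
        \sum_i w ord0 i = 1 & x = w *m A]].

Definition simplex A := face A [set: 'I_d.+1].

Definition nondegenerate (A : 'M[R]_(d.+1, d)) :=
  row_free (row_mx (const_mx 1 : 'cV[R]_d.+1) A).

Definition diameter K : R := sup [set enorm (x - y) | x in K & y in K].

Definition conforming_triangulation Om (Th : seq 'M[R]_(d.+1, d)) :=
  [/\ forall A, A \in Th -> nondegenerate A,
      closure Om = \bigcup_(A in [set` Th]) simplex A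
    & forall A B, A \in Th -> B \in Th -> exists S S' : {set 'I_d.+1},
        simplex A `&` simplex B = face A S /\
        simplex A `&` simplex B = face B S'].

Definition mesh_size (Th : seq 'M[R]_(d.+1, d)) (h : R) :=
  (forall A, A \in Th -> diameter (simplex A) <= h) /\
  (exists2 A, A \in Th & diameter (simplex A) = h).

Definition shape_regular (Hs : set R) (Th : R -> seq 'M[R]_(d.+1, d)) :=
  exists sigma : R, forall h A, Hs h -> A \in Th h ->
    exists rho x, [/\ 0 < rho, diameter (simplex A) <= sigma * rho &
      [set y | enorm (y - x) <= rho] `<=` simplex A].

Definition quasi_uniform (Hs : set R) (Th : R -> seq 'M[R]_(d.+1, d)) :=
  exists tau : R, forall h A, Hs h -> A \in Th h ->
    h <= tau * diameter (simplex A).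

(* The family is indexed by its mesh sizes, which form the set Hs. *)
Definition triangulation_family Om (Hs : set R)
    (Th : R -> seq 'M[R]_(d.+1, d)) :=
  [/\ forall h, Hs h -> [/\ 0 < h, conforming_triangulation Om (Th h) &
                            mesh_size (Th h) h],
      shape_regular Hs Th & quasi_uniform Hs Th].

End geometry.

(* Main.v *)
Require Import Defs.
From mathcomp Require Import all_boot all_order all_algebra.
From mathcomp Require Import all_classical all_reals all_analysis.
From mathcomp Require Import measurable_realfun ring lra.

Set Implicit Arguments.
Unset Strict Implicit.
Unset Printing Implicit Defensive.

Import Order.TTheory GRing.Theory Num.Theory.
Import numFieldNormedType.Exports.

Local Open Scope classical_set_scope.
Local Open Scope ring_scope.

(** The operator is the discrete Stokes projection: F v in X_h, together with a
    pressure G v in M_h, solves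

      (grad (F v), grad w) - (div w, G v) = (grad v, grad w)   for w in X_h,
      (div (F v), q) = (div v, q)                               for q in M_h.

    The second line is the Fortin property.  The problem has a unique solution
    by Poincare's inequality, which controls the velocity, and by the LBB
    condition, which controls the pressure.  Hence F is linear, and it is a
    projection because (F v, 0) solves the problem with data F v.  The same two
    ingredients give a bound, uniform in h, of the gradient of the error
    e = v - F v and of the pressure G v by the gradient of v
    ([projection_err_le], [projection_pressure_le]).

    The factor h comes from duality.  Let (psi, theta) solve the Stokes problem
    with right-hand side e.  Testing it with e gives
    |e|^2 = (grad psi, grad e) - (div e, theta).  Discrete fields and pressures
    can be subtracted from psi and theta at the price of the pressure G v
    ([projection_duality]), and their Scott-Zhang interpolants leave a factor
    h (|psi|_2 + |theta|_1), which is at most c h |e| by regularity; one factor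
    |e| cancels.

    Elements of the Sobolev spaces are functions whose weak derivatives are
    chosen representatives.  All forms above are bilinear only because weak
    derivatives are unique almost everywhere, that is, because of the
    fundamental lemma of the calculus of variations ([fundamental_lemma]).  Its
    proof needs smooth functions with compact support that approximate the
    indicators of boxes; these are built from exp (- 1 / t).  The other analytic
    ingredient is that the integral of a partial derivative of a compactly
    supported function vanishes ([int_pderiv0]): it shows that the weak
    derivatives of a test function are its classical ones, and it yields
    Poincare's inequality when applied to x_i * phi ^ 2.  Identities for fields
    of H^1_0 are then obtained from test functions by density
    ([H10_density]). *)

(** * Measurability and finiteness on row vectors *)

Section rV_measure.
Variables (R : realType) (n : nat).
Implicit Types (Om : set 'rV[R]_n) (f : 'rV[R]_n -> R).

Lemma measurable_coordwise (P : 'I_n -> set (measurableTypeR R)) :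
  (forall i, measurable (P i)) ->
  measurable [set y : 'rV[R]_n | forall i, P i (y ord0 i)].
Proof.
move=> mP; have -> : [set y : 'rV[R]_n | forall i, P i (y ord0 i)] =
    \big[setI/setT]_(i <- index_enum 'I_n)
       ((fun y : 'rV[R]_n => y ord0 i) @^-1` P i).
  rewrite -bigcap_seq; apply/seteqP; split => y /= Py i; first by move=> _; exact: Py.
  by apply: Py; rewrite /= mem_index_enum.
apply: bigsetI_measurable => i _.
by rewrite -[X in measurable X]setTI; exact: measurable_coord.
Qed.

Definition cube (K : R) : set 'rV[R]_n := [set y | forall i, `|y ord0 i| <= K].

Lemma cubeE K : cube K = [set y | forall i, `[- K, K]%classic (y ord0 i)].
Proof.
by apply/seteqP; split => y /= yK i; move: (yK i); rewrite /= in_itv/= ler_norml.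
Qed.

Lemma measurable_cube K : measurable (cube K).
Proof.
rewrite cubeE; apply: (@measurable_coordwise (fun=> `[- K, K]%classic)) => i.
exact: measurable_itv.
Qed.

Lemma compact_cube K : compact (cube K).
Proof.
rewrite cubeE; apply: (@rV_compact _ _ (fun=> `[- K, K]%classic)) => _.
exact: segment_compact.
Qed.

Lemma cube_norm (y : 'rV[R]_n) : cube `|y| y.
Proof.
have := lexx `|y|; rewrite {1}/Num.norm /= mx_normrE => /bigmax_leP[_ H] i.
by apply: (H (ord0, i)).
Qed.

(** Rational centres and radii 1 / (k + 1) make this a countable base of the
    topology: open sets are measurable, and properties holding almost everywhere
    on each small cube hold almost everywhere. *)
Definition qcube (p : 'rV[rat]_n * nat) : set 'rV[R]_n :=
  [set y | forall i, ratr (p.1 ord0 i) - p.2.+1%:R^-1 < y ord0 i <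
                     ratr (p.1 ord0 i) + p.2.+1%:R^-1].

Definition closed_qcube (p : 'rV[rat]_n * nat) : set 'rV[R]_n :=
  [set y | forall i, ratr (p.1 ord0 i) - p.2.+1%:R^-1 <= y ord0 i <=
                     ratr (p.1 ord0 i) + p.2.+1%:R^-1].

Lemma measurable_qcube p : measurable (qcube p).
Proof.
pose P (i : 'I_n) : set (measurableTypeR R) :=
  `]ratr (p.1 ord0 i) - p.2.+1%:R^-1, ratr (p.1 ord0 i) + p.2.+1%:R^-1[%classic.
have -> : qcube p = [set y : 'rV[R]_n | forall i, P i (y ord0 i)].
  by apply/seteqP; split => y /= yK i; move: (yK i); rewrite /P /= in_itv.
by apply: measurable_coordwise => i; exact: measurable_itv.
Qed.

Lemma qcube_base Om x : open Om -> Om x ->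
  exists2 p, qcube p x & closed_qcube p `<=` Om.
Proof.
move=> oOm Omx; have /nbhs_ballP[e /= e0 eOm] := open_nbhs_nbhs (conj oOm Omx).
have [k _ ke] := near_infty_natSinv_lt (PosNum (divr_gt0 e0 (@ltr0n R 3))).
have {}ke : k.+1%:R^-1 < e / 3 by have := ke k (leqnn k).
have k0 : 0 < k.+1%:R^-1 :> R by rewrite invr_gt0.
rewrite /closed_qcube /qcube.
have /choice[q hq] (i : 'I_n) : exists q : rat,
    x ord0 i - k.+1%:R^-1 < ratr q < x ord0 i + k.+1%:R^-1.
  have : x ord0 i - k.+1%:R^-1 < x ord0 i + k.+1%:R^-1 by rewrite ltrD2l gt0_cp.
  by move=> /rat_in_itvoo[q]; rewrite in_itv; exists q.
exists (\row_i q i, k) => [i|y yq] /=.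
  rewrite mxE; have /andP[] := hq i.
  by rewrite ltrBlDr => -> ; rewrite -ltrBlDr => ->.
apply: eOm; split=> // i j; rewrite ord1.
have := hq j; have := yq j; rewrite /= mxE /ball /= ltr_norml.
by move: k.+1%:R^-1 k0 ke => r; lra.
Qed.

Lemma open_bigcup_qcube Om : open Om ->
  Om = \bigcup_(p in [set p | closed_qcube p `<=` Om]) qcube p.
Proof.
move=> oOm; apply/seteqP; split => [x Omx|x [p pOm px]].
  by have [p px pOm] := qcube_base oOm Omx; exists p.
by apply: pOm => i; have /andP[/ltW-> /ltW->] := px i.
Qed.

Lemma open_measurable_rV Om : open Om -> measurable Om.
Proof.
move=> /open_bigcup_qcube ->; rewrite bigcup_mkcond.
apply: countable_bigcupT_measurable => [|p]; first exact: countableP.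
by case: ifPn => // _; exact: measurable_qcube.
Qed.

Lemma continuous_measurable_rV f : continuous f ->
  measurable_fun setT (f : 'rV[R]_n -> measurableTypeR R).
Proof.
move=> cf; apply: (measurability _ (RGenOInfty.measurableE R)).
move=> /= _ [_ [a ->]] <-; apply: measurableI => //.
apply: open_measurable_rV; apply: open_comp; first by move=> x _; exact: cf.
exact: interval_open.
Qed.

End rV_measure.

Lemma lebesgue_cube_lty (R : realType) n (K : R) :
  (lebesgue_rV R n (cube K) < +oo)%E.
Proof.
elim: n => [|n IH] /=; first by rewrite /dirac/= indicE; case: (_ \in _); rewrite ltry.
rewrite /lebesgue_cons /pushforward.
have -> : @consrV R n @^-1` cube K = `[- K, K]%classic `*` cube K.
  apply/seteqP; split => -[t y] /=.
    move=> ty; split.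
      have := ty (lshift n ord0 : 'I_(1 + n)).
      by rewrite (@row_mxEl R 1 1 n) mxE in_itv/= ler_norml.
    move=> i; have := ty (rshift 1 i : 'I_(1 + n)).
    by rewrite (@row_mxEr R 1 1 n).
  move=> [tK yK] i; case: (@split_ordP 1 n i) => j ->; rewrite /=.
    by rewrite (@row_mxEl R 1 1 n) mxE ler_norml; move: tK; rewrite /= in_itv.
  by rewrite (@row_mxEr R 1 1 n).
rewrite product_measure1E//; last exact: measurable_cube.
have Kfin : (lebesgue_measure (`[(- K)%R, K]%classic : set R) < +oo)%E.
  by rewrite lebesgue_measure_itv/=; case: ifP => _ //; rewrite -EFinD ltry.
by rewrite lte_mul_pinfty// ge0_fin_numE.
Qed.

Section rV_integrable.
Variables (R : realType) (n : nat).
Local Notation mu := (lebesgue_rV R n).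
Implicit Types (f : 'rV[R]_n -> R).

Lemma bounded_cube_integrable f (D : set 'rV[R]_n) K M : measurable D ->
  measurable_fun D (f : _ -> measurableTypeR R) -> (forall x, D x -> `|f x| <= M) ->
  (forall x, D x -> ~ cube K x -> f x = 0) -> mu.-integrable D (EFin \o f).
Proof.
move=> mD mf fM fK.
apply: (@le_integrable _ _ _ mu _ mD _ (EFin \o (fun x => M * \1_(cube K) x))).
- exact/measurable_EFinP.
- move=> x Dx; rewrite /= lee_fin indicE; case: (boolP (x \in cube K)).
    by move=> _; rewrite mulr1 (le_trans (fM _ Dx))// ler_norm.
  by move=> /negP xK; rewrite mulr0 fK// ?normr0// => /mem_set.
- apply: (integrableS measurableT) => //.
  have := @integrableZl _ _ _ mu _ measurableT M (EFin \o \1_(cube K : set 'rV[R]_n)).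
  apply; apply/integrableP; split.
    by apply/measurable_EFinP; apply: measurable_indic; exact: measurable_cube.
  under eq_integral do rewrite /= ger0_norm//.
  by rewrite integral_indic ?setIT//; [exact: lebesgue_cube_lty|exact: measurable_cube].
Qed.

Lemma continuous_bounded_cube f K : continuous f ->
  exists M, forall x, cube K x -> `|f x| <= M.
Proof.
move=> cf; have := @continuous_compact _ _ f (cube K) _ (@compact_cube _ _ K).
move=> /(_ (continuous_subspaceT cf)) /compact_bounded [M [_ /(_ (M + 1)) MP]].
exists (M + 1) => x xK; apply: MP; last by exists x.
by rewrite ltrDl.
Qed.

Lemma continuous_cube_integrable f K : continuous f ->
  (forall x, ~ cube K x -> f x = 0) -> mu.-integrable setT (EFin \o f).
Proof.
move=> cf fK; have [M fM] := continuous_bounded_cube K cf.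
apply: (@bounded_cube_integrable _ _ K `|M|) => //.
- exact: continuous_measurable_rV.
- move=> x _; have [/fM/le_trans->//|/fK->] := pselect (cube K x).
    by rewrite ler_norm.
  by rewrite normr0.
- by move=> x _; exact: fK.
Qed.

End rV_integrable.

(** * The integral of a partial derivative *)

Section int_pderiv.
Variable R : realType.

Lemma int_derive0 (f g : R -> R) K : (forall t : R, is_derive t (1 : R) f (g t)) ->
  continuous g -> (forall t, K < `|t| -> f t = 0) ->
  (\int[@lebesgue_measure R]_t (g t)%:E = 0)%E.
Proof.
move=> fg cg fK.
pose a := `|K| + 1.
have Ka : K < a by rewrite /a (le_lt_trans (ler_norm _))// ltrDl.
have a0 : 0 < a by rewrite /a ltr_wpDl.
have g0 t : K < `|t| -> g t = 0.
  move=> Kt; have [_ <-] := fg t.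
  rewrite (@near_eq_derive _ _ _ f (cst 0)) ?derive_cst//.
  have : \forall s \near t, K < `|s|.
    have := @norm_continuous _ R^o t; move=> /(_ [set s | K < s]); apply.
    exact: lt_nbhsr.
  by apply: filterS => s /fK.
have cf : continuous f.
  by move=> t; apply: differentiable_continuous; apply/derivable1_diffP; have [] := fg t.
have -> : (\int[@lebesgue_measure R]_t (g t)%:E =
    \int[@lebesgue_measure R]_(t in `[(- a)%R, a]) (g t)%:E)%E.
  rewrite [RHS]integral_mkcond; apply: eq_integral => t _.
  rewrite patchE; case: ifPn => // /negP ta; rewrite g0// (lt_le_trans Ka)//.
  rewrite leNgt; apply/negP => /ltW ta'; apply: ta; rewrite inE /= in_itv /=.
  by rewrite -ler_norml.
rewrite (@continuous_FTC2 _ g f); first by rewrite !fK ?normrN ?gtr0_norm// subee.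
- by rewrite gt0_cp.
- exact: continuous_subspaceT.
- split; first by move=> t _; have [] := fg t.
    by apply: cvg_at_right_filter; exact: cf.
  by apply: cvg_at_left_filter; exact: cf.
- by move=> t _; rewrite derive1E; have [_] := fg t.
Qed.

Lemma consrV_derive0 n (F : 'rV[R]_n.+1 -> R) t y :
  (fun h => h^-1 *: ((F \o shift (consrV (t, y))) (h *: delta_mx ord0 ord0) -
     F (consrV (t, y)))) =
  (fun h : R => h^-1 *: (((fun s => F (consrV (s, y))) \o shift t) (h *: (1 : R^o)) -
     F (consrV (t, y)))).
Proof.
apply/funext => h /=; congr (_ *: (F _ - _)).
apply/rowP => i; rewrite /consrV mxE; case: (@split_ordP 1 n i) => j ->.
  rewrite !(@row_mxEl R 1 1 n) !mxE (ord1 j) /=.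
  by [].
rewrite !(@row_mxEr R 1 1 n) !mxE /=.
by rewrite mulr0 add0r.
Qed.

Lemma consrV_deriveS n (F : 'rV[R]_n.+1 -> R) t y (i : 'I_n) :
  (fun h => h^-1 *: ((F \o shift (consrV (t, y)))
                      (h *: delta_mx ord0 (rshift 1 i : 'I_(1 + n))) -
     F (consrV (t, y)))) =
  (fun h : R => h^-1 *: (((fun z => F (consrV (t, z))) \o shift y) (h *: delta_mx ord0 i) -
     F (consrV (t, y)))).
Proof.
apply/funext => h /=; congr (_ *: (F _ - _)).
apply/rowP => k; rewrite /consrV mxE; case: (@split_ordP 1 n k) => j ->.
  rewrite !(@row_mxEl R 1 1 n) !mxE /= ?mulr0 ?add0r.
  by rewrite eq_lrshift mulr0 add0r.
by rewrite !(@row_mxEr R 1 1 n) /= !mxE /= eq_rshift.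
Qed.

Lemma continuous_consrV n t (G : 'rV[R]_n.+1 -> R) : continuous G ->
  continuous (fun y : 'rV[R]_n => G (consrV (t, y))).
Proof.
move=> cG y; apply: (@continuous_comp _ _ _ (fun y => consrV (t, y)) G); last exact: cG.
have FF : Filter (nbhs y) by exact: nbhs_filter.
apply/(@cvg_ballP R 'rV[R]_n.+1 _ (nbhs y) FF) => e e0.
apply: filterS (nbhsx_ballx y _ e0) => z [_ yz].
split=> // k i; rewrite ord1 /consrV.
case: (@split_ordP 1 n i) => j ->.
  by rewrite !(@row_mxEl R 1 1 n) !mxE; exact: ballxx.
by rewrite !(@row_mxEr R 1 1 n) /=; exact: yz.
Qed.

Lemma continuous_consrV1 n y (G : 'rV[R]_n.+1 -> R) : continuous G ->
  continuous (fun t : R => G (consrV (t, y))).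
Proof.
move=> cG t; apply: (@continuous_comp _ _ _ (fun t : R => consrV (t, y)) G); last exact: cG.
apply/cvg_ballP => e e0; near=> z.
split=> // k i; rewrite ord1 /consrV.
case: (@split_ordP 1 n i) => j ->.
  rewrite !(@row_mxEl R 1 1 n) !mxE /=.
  by near: z; exists e.
by rewrite !(@row_mxEr R 1 1 n) /=; exact: ballxx.
Unshelve. all: end_near. Qed.

(** For the first coordinate, integrate it out first and use the fundamental
    theorem of calculus; for another one, integrate the first coordinate out
    last and argue by induction on the slices. *)
Lemma int_pderiv0 n (i : 'I_n) (F G : 'rV[R]_n -> R) K :
  (forall x, is_derive x (delta_mx ord0 i) F (G x)) -> continuous G ->
  (forall x, ~ cube K x -> F x = 0) ->
  (\int[lebesgue_rV R n]_x (G x)%:E = 0)%E.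
Proof.
elim: n => [|n IH] in i F G *; first by case: i.
move=> FG cG FK.
have G0 x : ~ cube K x -> G x = 0.
  move=> xK; have [_ <-] := FG x.
  rewrite (@near_eq_derive _ _ _ F (cst 0)) ?derive_cst//.
  have oK : open (~` @cube R n.+1 K).
    by apply: closed_openC; apply: compact_closed => //; exact: compact_cube.
  by apply: filterS (open_nbhs_nbhs (conj oK xK)) => z /FK.
have GI := continuous_cube_integrable cG G0.
pose m := lebesgue_rV R n.
have mG := continuous_measurable_rV cG.
have mGc : measurable_fun setT (EFin \o G \o @consrV R n).
  apply: measurableT_comp; last exact: measurable_consrV.
  exact/measurable_EFinP.
have iGc : (@lebesgue_measure R \x m)%E.-integrable setT (EFin \o G \o @consrV R n).
  apply/integrableP; split => //.
  have /integrableP[_] := GI; rewrite /= /lebesgue_cons.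
  rewrite (@ge0_integral_pushforward _ _ _ _ _ (@consrV R n) (@measurable_consrV R n)) //.
  apply: measurableT_comp => //.
   exact: measurableT_comp.
have -> : (\int[lebesgue_rV R n.+1]_x (G x)%:E =
    \int[(@lebesgue_measure R \x m)%E]_p (EFin \o G \o @consrV R n) p)%E.
  rewrite /= /lebesgue_cons.
  rewrite (@integral_pushforward _ _ _ _ _ (@consrV R n) (@measurable_consrV R n)) //.
  exact/measurable_EFinP.
case: (@split_ordP 1 n i) FG => j -> FG.
  rewrite -integral21_prod_meas1//; apply: integral0_eq => y _ /=.
  apply: (@int_derive0 (fun t => F (consrV (t, y))) _ K).
  - move=> t; have [d1 d2] := FG (consrV (t, y)).
    have jE : lshift n j = ord0 by apply: val_inj; rewrite /= (ord1 j).
    rewrite jE in d1 d2.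
    by split; [rewrite /derivable -consrV_derive0|rewrite -d2 /derive -consrV_derive0].
  - exact: continuous_consrV1.
  - move=> t Kt; apply: FK => /(_ (lshift n ord0 : 'I_(1 + n))).
    by rewrite (@row_mxEl R 1 1 n) mxE leNgt Kt.
rewrite -integral12_prod_meas1//; apply: integral0_eq => t _ /=.
apply: (IH j (fun y => F (consrV (t, y)))).
- move=> y; have [d1 d2] := FG (consrV (t, y)).
  by split; [rewrite /derivable -consrV_deriveS|rewrite -d2 /derive -consrV_deriveS].
- exact: continuous_consrV.
- move=> y yK; apply: FK => xK; apply: yK => k.
  by have := xK (rshift 1 k : 'I_(1 + n)); rewrite (@row_mxEr R 1 1 n).
Qed.

End int_pderiv.

(** * Smooth bump functions *)

Section flat.
Variable R : realType.

(** These functions vanish to infinite order at 0, and the family is stable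
    under differentiation; [flat 1] is the usual exp (- 1 / t). *)
Definition flat (P : {poly R}) (t : R) : R :=
  if 0 < t then P.[t^-1] * expR (- t^-1) else 0.

Definition flat_deriv (P : {poly R}) : {poly R} := 'X^2 * (P - P^`()).

Lemma expr_le_expR k : exists2 C : R, 0 <= C & forall s, 0 <= s -> s ^+ k <= C * expR s.
Proof.
case: k => [|k].
  by exists 1 => // s s0; rewrite expr0 mul1r -expR0 ler_expR.
exists k.+1`!%:R => // s s0; rewrite -ler_pdivrMl ?ltr0n ?fact_gt0//.
by rewrite mulrC; apply: le_trans (expR_ge1Dxn k s0); rewrite lerDr.
Qed.

(** The extra power of [s] is what the induction on [P] needs, as it trades a
    factor 'X of the polynomial for a power of [s]. *)
Lemma horner_le_expR (P : {poly R}) k :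
  exists2 C : R, 0 <= C & forall s, 0 <= s -> `|P.[s]| * s ^+ k <= C * expR s.
Proof.
elim/poly_ind: P k => [|P c IH] k.
  by exists 0 => // s s0; rewrite horner0 normr0 !mul0r.
have [C1 C10 h1] := IH k.+1; have [C2 C20 h2] := expr_le_expR k.
exists (C1 + `|c| * C2) => [|s s0]; first by rewrite addr_ge0// mulr_ge0.
rewrite hornerMXaddC (le_trans (ler_wpM2r _ (ler_normD _ _))) ?exprn_ge0//.
rewrite !mulrDl lerD//.
  by rewrite normrM (ger0_norm s0) -mulrA -exprS h1.
by rewrite -mulrA ler_wpM2l// h2.
Qed.

(** Order 2 is what makes the derivative at 0 vanish. *)
Lemma flat_quadratic (P : {poly R}) :
  exists2 C : R, 0 <= C & forall t, `|flat P t| <= C * t ^+ 2.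
Proof.
have [C C0 h] := horner_le_expR P 2; exists C => // t; rewrite /flat.
case: ifPn => [t0|_]; last by rewrite normr0 mulr_ge0// sqr_ge0.
have := h t^-1; rewrite invr_ge0 => /(_ (ltW t0)).
rewrite exprVn ler_pdivrMr ?exprn_gt0// normrM (ger0_norm (expR_ge0 _)) => ht.
by rewrite expRN ler_pdivrMr ?expR_gt0// mulrAC.
Qed.

Lemma is_derive_flat (P : {poly R}) (t : R) :
  is_derive t (1 : R) (flat P) (flat (flat_deriv P) t).
Proof.
have [t0|t0|->] := ltgtP t 0.
- have -> : flat (flat_deriv P) t = 0 by rewrite /flat ltNge (ltW t0).
  have nr : \forall s \near t, (cst 0 : R -> R) s = flat P s.
    near=> s; rewrite /flat ltNge ltW//=.
    by near: s; exact: lt_nbhsl.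
  exact: (near_eq_is_derive nr (is_derive_cst (0 : R) t (1 : R))).
- rewrite {2}/flat t0.
  apply: (@near_eq_is_derive _ _ _ (fun s : R => P.[s^-1] * expR (- s^-1))).
    near=> s; rewrite /flat ifT//.
    by near: s; exact: lt_nbhsr.
  have dV : is_derive t (1 : R) (fun s : R => s^-1) (- t ^- 2).
    have := @is_deriveV R id t 1 1 (lt0r_neq0 t0) _.
    by rewrite /GRing.scale /= mulr1; apply; exact: is_derive_id.
  have dP : is_derive t (1 : R) (horner P \o (fun s : R => s^-1)) (P^`().[t^-1] * - t ^- 2).
    exact: is_derive1_comp.
  have dN : is_derive t (1 : R) (fun s : R => - s^-1) (t ^- 2).
    by rewrite -[t ^- 2]opprK; exact: is_deriveN.
  have dE : is_derive t (1 : R) (expR \o (fun s : R => - s^-1)) (expR (- t^-1) * t ^- 2).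
    exact: is_derive1_comp.
  have := is_deriveM dP dE.
  rewrite /= => H; apply: (is_derive_eq H).
  rewrite /flat_deriv /GRing.scale /= hornerM hornerXn hornerD hornerN exprVn.
  by ring.
- rewrite {2}/flat ltxx.
  have [C C0 hC] := flat_quadratic P.
  have fl0 : flat P 0 = 0 by rewrite /flat ltxx.
  have H : (fun h : R => h^-1 *: ((flat P \o shift (0 : R)) (h *: (1:R)) - flat P 0))
      @ (0 : R)^' --> (0 : R).
    apply/cvgrPdist_le => e e0; near=> h.
    rewrite sub0r normrN fl0 subr0 /= addr0 /GRing.scale/= mulr1 normrM normfV.
    have h0 : h != 0 by near: h; exact: nbhs_dnbhs_neq.
    rewrite ler_pdivrMl ?normr_gt0//.
    apply: (le_trans (hC h)); rewrite -[h ^+ 2]real_normK ?num_real//.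
    rewrite expr2 mulrCA ler_wpM2l//.
    have hC1 : `|h| <= e / (C + 1).
      near: h; apply: dnbhs0_le; rewrite divr_gt0// ltr_wpDl//.
    apply: (le_trans (ler_wpM2l C0 hC1)).
    rewrite mulrCA ger_pMr// ler_pdivrMr ?mul1r ?lerDl//.
    by rewrite ltr_wpDl.
  split; first by apply/cvg_ex; exists 0.
  by apply: cvg_lim.
Unshelve. all: by end_near. Qed.

Lemma flat1_gt0 t : (0 < flat 1 t) = (0 < t).
Proof. by rewrite /flat; case: ifP => _; rewrite ?ltxx// hornerC mul1r expR_gt0. Qed.

Lemma flat1_ge0 t : 0 <= flat 1 t.
Proof. by rewrite /flat; case: ifP => _ //; rewrite hornerC mul1r expR_ge0. Qed.

Lemma flat1_le1 t : flat 1 t <= 1.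
Proof.
rewrite /flat; case: ifP => t0 //; rewrite hornerC mul1r expR_le1 oppr_le0.
by rewrite invr_ge0 ltW.
Qed.

End flat.

Section bumpy.
Variables (R : realType) (n : nat).
Local Notation V := 'rV[R]_n.

(** A class of functions that is stable under partial derivatives by
    construction, so that the smoothness of its members is a plain induction. *)
Inductive bumpy : (V -> R) -> Prop :=
| bumpy_cst c : bumpy (fun=> c)
| bumpy_flat P i a b : bumpy (fun x => flat P (a * x ord0 i + b))
| bumpy_add f g : bumpy f -> bumpy g -> bumpy (f + g)
| bumpy_mul f g : bumpy f -> bumpy g -> bumpy (f * g).

Lemma is_derive_coord (x v : V) i : is_derive x v (fun y : V => y ord0 i : R) (v ord0 i).
Proof.
have dc : derivable (fun y : V => y ord0 i : R) x v.
  by apply: diff_derivable; exact: differentiable_coord.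
split=> //; apply: cvg_lim => //.
apply: cvg_near_cst; near=> h => /=.
rewrite !mxE addrK /GRing.scale /= mulrA mulVf ?mul1r//.
by near: h; exact: nbhs_dnbhs_neq.
Unshelve. all: by end_near. Qed.

Lemma is_derive_comp_real (f : R -> R) (g : V -> R) (x v : V) df dg :
  differentiable g x -> is_derive (g x) (1 : R) f df -> is_derive x v g dg ->
  is_derive x v (f \o g) (df * dg).
Proof.
move=> gx [fd <-] [gd <-].
have fx : differentiable f (g x) by apply/derivable1_diffP.
have fgx : differentiable (f \o g) x by exact: differentiable_comp.
split; first exact: diff_derivable.
have -> : 'D_v g x = 'd g x v by rewrite deriveE.
by rewrite deriveE// diff_comp//= (deriv1E fd) derive1E mulrC.
Qed.

Lemma bumpy_flat_derive P i a b (x v : V) :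
  differentiable (fun x : V => flat P (a * x ord0 i + b)) x /\
  is_derive x v (fun x : V => flat P (a * x ord0 i + b))
    (flat (flat_deriv P) (a * x ord0 i + b) * (a * v ord0 i)).
Proof.
pose g (y : V) : R := a * y ord0 i + b.
have cd := is_derive_coord x v i.
have gd : differentiable g x.
  apply: (@differentiableD _ _ _ (fun y : V => a * y ord0 i) (cst b)) => //.
  apply: (@differentiableZ _ _ _ (fun y : V => y ord0 i : R^o) a).
  exact: differentiable_coord.
have dg : is_derive x v g (a * v ord0 i).
  have h1 := @is_deriveZ R V R^o _ a _ _ _ cd.
  have := @is_deriveD _ _ _ _ _ _ _ _ _ h1 (is_derive_cst b x v).
  by rewrite addr0.
split; last exact: (is_derive_comp_real gd (is_derive_flat P (g x)) dg).
apply: (differentiable_comp gd); apply/derivable1_diffP.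
by have [] := is_derive_flat P (g x).
Qed.

Lemma bumpy_differentiable f : bumpy f -> forall x, differentiable f x.
Proof.
elim=> [c|P i a b|{}f g _ df _ dg|{}f g _ df _ dg] x.
- exact: differentiable_cst.
- by have [] := bumpy_flat_derive P i a b x 0.
- exact: differentiableD.
- exact: differentiableM.
Qed.

Lemma bumpy_pderiv i f : bumpy f -> bumpy (pderiv i f).
Proof.
elim=> [c|P j a b|{}f g bf df bg dg|{}f g bf df bg dg].
- rewrite (_ : pderiv i _ = fun=> 0); first exact: bumpy_cst.
  by apply/funext => x; exact: derive_cst.
- rewrite (_ : pderiv i _ = (fun x => flat (flat_deriv P) (a * x ord0 j + b)) *
     (fun=> a * (delta_mx ord0 i : V) ord0 j)).
    by apply: bumpy_mul; [exact: bumpy_flat|exact: bumpy_cst].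
  by apply/funext => x; have [_ []] := bumpy_flat_derive P j a b x (delta_mx ord0 i).
- rewrite (_ : pderiv i _ = pderiv i f + pderiv i g); first exact: bumpy_add.
  apply/funext => x; rewrite /pderiv deriveD//; exact/diff_derivable/bumpy_differentiable.
- rewrite (_ : pderiv i _ = f * pderiv i g + g * pderiv i f).
    by apply: bumpy_add; exact: bumpy_mul.
  apply/funext => x; rewrite /pderiv deriveM//; exact/diff_derivable/bumpy_differentiable.
Qed.

Lemma bumpy_smooth f : bumpy f -> smooth f.
Proof.
move=> bf s x; apply: bumpy_differentiable.
by elim: s => //= i s; exact: bumpy_pderiv.
Qed.

Lemma bumpy_prod (F : 'I_n -> V -> R) : (forall i, bumpy (F i)) ->
  bumpy (fun x => \prod_(i < n) F i x).
Proof.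
move=> bF; elim: (index_enum _) => [|i s IH].
  rewrite (_ : (fun _ => _) = fun=> 1); first exact: bumpy_cst.
  by apply/funext => x; rewrite big_nil.
rewrite (_ : (fun _ => _) = F i * (fun x => \prod_(j <- s) F j x)).
  exact: bumpy_mul.
by apply/funext => x; rewrite big_cons.
Qed.

Lemma bumpy_exp f k : bumpy f -> bumpy (fun x => f x ^+ k).
Proof.
move=> bf; elim: k => [|k IH].
  by rewrite (_ : (fun _ => _) = fun=> 1); first exact: bumpy_cst.
rewrite (_ : (fun _ => _) = f * (fun x => f x ^+ k)); first exact: bumpy_mul.
by apply/funext => x; rewrite exprS.
Qed.

Definition bump (l r : V) (x : V) : R :=
  \prod_(i < n) (flat 1 (x ord0 i - l ord0 i) * flat 1 (r ord0 i - x ord0 i)).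

Definition open_box (l r : V) : set V :=
  [set x | forall i, l ord0 i < x ord0 i < r ord0 i].

Lemma bumpy_bump l r : bumpy (bump l r).
Proof.
apply: bumpy_prod => i; apply: bumpy_mul.
  have := bumpy_flat 1 i 1 (- l ord0 i).
  by congr bumpy; apply/funext => x; rewrite mul1r.
have := bumpy_flat 1 i (- 1) (r ord0 i).
by congr bumpy; apply/funext => x; rewrite mulN1r addrC.
Qed.

Lemma bump_ge0 l r x : 0 <= bump l r x.
Proof. by apply: prodr_ge0 => i _; rewrite mulr_ge0// flat1_ge0. Qed.

Lemma bump_le1 l r x : bump l r x <= 1.
Proof.
apply: prodr_ile1 => i _.
by rewrite mulr_ge0 ?flat1_ge0//= mulr_ile1// ?flat1_ge0 ?flat1_le1.
Qed.

Lemma bump_gt0 l r x : (0 < bump l r x) <-> open_box l r x.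
Proof.
split=> [|lxr].
  rewrite lt_def => /andP[b0 _] i.
  move/prodf_neq0 : b0 => /(_ i isT); rewrite mulf_eq0 negb_or => /andP[h1 h2].
  apply/andP; split; rewrite -subr_gt0 -flat1_gt0 lt_def ?h1 ?h2.
    exact: flat1_ge0.
  exact: flat1_ge0.
apply: prodr_gt0 => i _; have /andP[h1 h2] := lxr i.
by rewrite mulr_gt0// flat1_gt0 subr_gt0.
Qed.

(** The values of the bump are pushed to 1 on the whole box as [k] grows, as the
    approximation of the indicator of the box requires. *)
Definition bump_step (l r : V) k (x : V) : R := 1 - (1 - bump l r x) ^+ k.

Lemma bump_step_test (Om : set V) (l r : V) k :
  [set x : V | forall i, l ord0 i <= x ord0 i <= r ord0 i] `<=` Om ->
  test_function Om (bump_step l r k).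
Proof.
move=> lrO.
set B := [set x : V | _] in lrO.
have cB : compact B.
  have -> : B = [set v : V | forall i, `[l ord0 i, r ord0 i]%classic (v ord0 i)].
    by apply/seteqP; split => x /= xB i; have := xB i; rewrite /= in_itv.
  apply: (@rV_compact _ _ (fun i => `[l ord0 i, r ord0 i]%classic)) => i.
  exact: segment_compact.
have sB : closure [set x | bump_step l r k x != 0] `<=` B.
  have -> : B = closure B by apply/closure_id; exact: compact_closed.
  apply: closure_subset => x /= x0 i.
  have /bump_gt0 /(_ i)/andP[/ltW-> /ltW->]// : 0 < bump l r x.
  rewrite lt_def bump_ge0 andbT; apply: contra_neq x0 => b0.
  by rewrite /bump_step b0 subr0 expr1n subrr.
split.
- apply: bumpy_smooth.
  have -> : bump_step l r k = (fun=> 1) +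
      (fun=> -1) * (fun x => (((fun=> 1) + (fun=> -1) * bump l r) x) ^+ k).
    by apply/funext => x; rewrite /bump_step /= mulN1r fctE /= mulN1r.
  apply: bumpy_add; [exact: bumpy_cst|apply: bumpy_mul; [exact: bumpy_cst|]].
  apply: bumpy_exp; apply: bumpy_add; [exact: bumpy_cst|].
  by apply: bumpy_mul; [exact: bumpy_cst|exact: bumpy_bump].
- by apply: subclosed_compact sB => //; exact: closed_closure.
- by apply: subset_trans lrO.
Qed.

Lemma bump_step_ge0 l r k x : 0 <= bump_step l r k x.
Proof. by rewrite subr_ge0 exprn_ile1// ?subr_ge0 ?bump_le1// gerBl bump_ge0. Qed.

Lemma bump_step_le1 l r k x : bump_step l r k x <= 1.
Proof. by rewrite gerBl exprn_ge0// subr_ge0 bump_le1. Qed.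

Lemma bump_step_notin l r k x : ~ open_box l r x -> bump_step l r k x = 0.
Proof.
move=> /bump_gt0/negP; rewrite -leNgt => b0.
have -> : bump_step l r k x = 1 - (1 - bump l r x) ^+ k by [].
by rewrite (@le_anti _ _ (bump l r x) 0) ?b0 ?bump_ge0// subr0 expr1n subrr.
Qed.

Lemma bump_step_cvg l r x : bump_step l r ^~ x @ \oo --> (\1_(open_box l r) x : R).
Proof.
rewrite indicE; case: (boolP (x \in _)) => [/set_mem/bump_gt0 b0|/negP xb].
  rewrite -[X in _ --> X]subr0; apply: cvgB; first exact: cvg_cst.
  by apply: cvg_expr; rewrite ger0_norm ?gtrBl// subr_ge0 bump_le1.
apply: cvg_near_cst; apply: nearW => k; apply: bump_step_notin => /mem_set.
exact: xb.
Qed.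

End bumpy.

(** * The fundamental lemma of the calculus of variations *)

Section orthants.
Variables (R : realType) (n : nat).
Local Notation V := 'rV[R]_n.

(** The orthants form a generating pi-system, and each of them cuts a box in a
    box, where smooth approximations of the indicator are available. *)
Definition orthant (a : V) : set V := [set x | forall i, a ord0 i < x ord0 i].
Definition orthants : set (set V) := [set A | exists a, A = orthant a].

Lemma orthantI (a b : V) :
  orthant a `&` orthant b = orthant (\row_i Num.max (a ord0 i) (b ord0 i)).
Proof.
apply/seteqP; split=> x /=.
  by move=> [xa xb] i; rewrite mxE gt_max xa xb.
by move=> xab; split=> i; have := xab i; rewrite mxE gt_max => /andP[].
Qed.

Lemma coord_gt_bigcup_orthant (i : 'I_n) (c : R) :
  (fun y : V => y ord0 i) @^-1` `]c, +oo[%classic =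
  \bigcup_k orthant (\row_j if j == i then c else - k%:R).
Proof.
apply/seteqP; split=> x /=.
  rewrite in_itv /= andbT => cx.
  exists (Num.truncn `|x|).+1 => // j; rewrite mxE; case: eqP => [->//|_].
  rewrite ltrNl; apply: le_lt_trans (truncnS_gt _).
  by apply: le_trans (ler_norm _) _; rewrite normrN; exact: cube_norm.
by move=> [k _ /(_ i)]; rewrite mxE eqxx in_itv /= andbT.
Qed.

Lemma orthants_generate : @measurable _ V = <<s orthants >>.
Proof.
apply/seteqP; split; last first.
  apply: smallest_sub; first exact: sigma_algebra_measurable.
  move=> _ [a ->].
  apply: (@measurable_coordwise _ _ (fun i => [set t | a ord0 i < t])) => i.
  have -> : [set t : R | a ord0 i < t] = `]a ord0 i, +oo[%classic.
    by apply/seteqP; split=> t /=; rewrite in_itv /= andbT.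
  exact: measurable_itv.
apply: smallest_sub; first exact: smallest_sigma_algebra.
move=> B; rewrite -bigcup_seq => -[/= i _ [C mC <-]]; rewrite setTI.
pose P := [set C : set R | <<s orthants >> ((fun y : V => y ord0 i) @^-1` C)].
suff : (@measurable _ (measurableTypeR R)) `<=` P by apply.
rewrite RGenOInfty.measurableE; apply: smallest_sub.
  have [s0 sD sU] := @smallest_sigma_algebra _ [set: V] orthants.
  split.
  - by rewrite /P /= preimage_set0.
  - by move=> A PA; rewrite /P /= setTD preimage_setC -setTD; exact: sD.
  - by move=> F PF; rewrite /P /= preimage_bigcup; exact: sU.
move=> _ [c ->]; rewrite /P /= coord_gt_bigcup_orthant.
have [_ _ sU] := @smallest_sigma_algebra _ [set: V] orthants.
apply: sU => k; apply: sub_sigma_algebra.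
by eexists; reflexivity.
Qed.

End orthants.

Section fundamental_lemma.
Variables (R : realType) (n : nat).
Local Notation V := 'rV[R]_n.
Local Notation mu := (lebesgue_rV R n).
Variables (Om : set V) (w : V -> R).
Hypotheses (oOm : open Om) (w2 : L2 Om w).
Hypothesis w_test : forall phi, test_function Om phi ->
  \int[mu]_(x in Om) (w x * phi x) = 0.

Let mOm : measurable Om := open_measurable_rV oOm.

Lemma measurable_open_box (l r : V) : measurable (open_box l r).
Proof.
apply: (@measurable_coordwise _ _ (fun i => [set t | l ord0 i < t < r ord0 i])) => i.
have -> : [set t : R | l ord0 i < t < r ord0 i] = `]l ord0 i, r ord0 i[%classic.
  by apply/seteqP; split=> t /=; rewrite in_itv.
exact: measurable_itv.
Qed.

Lemma open_box_cube (l r : V) : open_box l r `<=` cube (`|l| + `|r|).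
Proof.
move=> x xlr i; have := xlr i; have := cube_norm l i; have := cube_norm r i.
by rewrite !ler_norml; move: `|l| `|r| => a b; lra.
Qed.

Lemma open_box_integrable (l r : V) : open_box l r `<=` Om ->
  mu.-integrable (open_box l r) (EFin \o w).
Proof.
move=> lrO; have [mw iw] := w2; have mB := measurable_open_box l r.
have mwB := measurable_funS mOm lrO mw.
have i1 : mu.-integrable (open_box l r) (EFin \o (fun=> 1)).
  apply: (@bounded_cube_integrable _ _ _ _ (`|l| + `|r|) 1) => //.
    by move=> x _; rewrite normr1.
  by move=> x /open_box_cube.
have i2 : mu.-integrable (open_box l r) (EFin \o (fun x => w x ^+ 2)).
  apply: (@integrableS _ _ _ _ Om) => //.
  apply/integrableP; split; first by apply/measurable_EFinP; exact: measurable_funX.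
  by under eq_integral do rewrite /= ger0_norm ?sqr_ge0//.
apply: (le_integrable mB _ _ (integrableD mB i1 i2)).
  exact/measurable_EFinP.
move=> x _ /=; rewrite lee_fin [leRHS]ger0_norm ?addr_ge0 ?sqr_ge0//.
have := sqr_ge0 (`|w x| - 1); rewrite sqrrB1 real_normK ?num_real// => h.
have := normr_ge0 (w x); have := sqr_ge0 (w x); nra.
Qed.

(** The smooth steps converge to the indicator of the box, boundedly, so that
    dominated convergence applies. *)
Lemma int_open_box0 (l r : V) :
  [set x : V | forall i, l ord0 i <= x ord0 i <= r ord0 i] `<=` Om ->
  (\int[mu]_(x in open_box l r) (w x)%:E = 0)%E.
Proof.
move=> lrO; have [mw _] := w2.
have blO : open_box l r `<=` Om.
  by move=> x xb; apply: lrO => i; have /andP[/ltW-> /ltW->] := xb i.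
have mB := measurable_open_box l r.
have iw := open_box_integrable blO.
have mb k : measurable_fun Om (bump_step l r k : _ -> measurableTypeR R).
  apply: measurable_funTS; apply: continuous_measurable_rV => x.
  apply: differentiable_continuous.
  by have [sm _ _] := bump_step_test k lrO; exact: (sm [::] x).
pose f_ k x := (w x * bump_step l r k x)%:E.
pose f x := (w x * \1_(open_box l r) x)%:E.
pose g x := (`|w x| * \1_(open_box l r) x)%:E.
have ig : mu.-integrable Om g.
  have := integrable_abse iw.
  rewrite (integrable_mkcond _ mB) => /(integrableS measurableT mOm (@subsetT _ _)).
  congr (mu.-integrable _ _); apply/funext => x; rewrite patchE /g indicE.
  by case: ifPn => _; rewrite ?mulr1 ?mulr0.
have [||||_ _ cv] := @dominated_convergence _ _ _ mu Om mOm f_ f g _ _ _ ig _.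
- move=> k; apply/measurable_EFinP; by apply: measurable_funM; [exact: mw|exact: mb].
- apply/measurable_EFinP; apply: measurable_funM => //.
- apply: aeW => x Ox; apply: cvg_EFin; first exact: nearW.
  by apply: cvgMr; exact: bump_step_cvg.
- apply: aeW => x k Ox; rewrite lee_fin normrM indicE.
  case: (boolP (x \in open_box l r)) => xb.
    by rewrite ler_wpM2l// ger0_norm ?bump_step_ge0// bump_step_le1.
  by rewrite bump_step_notin ?normr0 ?mulr0// => /mem_set; apply/negP.
have f0 k : (\int[mu]_(x in Om) f_ k x = 0)%E.
  have ifk : mu.-integrable Om (f_ k).
    apply: (le_integrable mOm _ _ ig).
      by apply/measurable_EFinP; apply: measurable_funM; [exact: mw|exact: mb].
    move=> x Ox; rewrite lee_fin normrM indicE.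
    case: (boolP (x \in open_box l r)) => xb.
      by rewrite mulr1 [leRHS]ger0_norm// ler_piMr// ger0_norm ?bump_step_ge0// bump_step_le1.
    by rewrite bump_step_notin ?normr0 ?mulr0// => /mem_set; apply/negP.
  have := w_test (bump_step_test k lrO); rewrite /Rintegral => h.
  by rewrite -[LHS]fineK ?h//; exact: integrable_fin_num.
have : (\int[mu]_(x in Om) f x = 0)%E.
  move/cvg_lim : cv => <- //; apply: lim_near_cst => //.
  exact: nearW.
rewrite -[RHS]/(0)%E => <-.
rewrite [LHS]integral_mkcond [RHS]integral_mkcond; apply: eq_integral => x _.
rewrite !patchE /f indicE.
case: ifPn => xb; last by case: ifP => // _; rewrite mulr0.
by rewrite ifT ?mulr1// inE; apply: blO; rewrite inE in xb.
Qed.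

(** By Dynkin's pi-lambda theorem it is enough to integrate over the part of the
    box in an orthant. *)
Lemma int_subset_box0 (l r : V) (A : set V) :
  [set x : V | forall i, l ord0 i <= x ord0 i <= r ord0 i] `<=` Om ->
  measurable A ->
  (\int[mu]_(x in open_box l r `&` A) (w x)%:E = 0)%E.
Proof.
move=> lrO; rewrite orthants_generate.
have blO : open_box l r `<=` Om.
  by move=> x xb; apply: lrO => i; have /andP[/ltW-> /ltW->] := xb i.
have mB := measurable_open_box l r.
have iw := open_box_integrable blO.
have iS (S : set V) : measurable S -> mu.-integrable (open_box l r `&` S) (EFin \o w).
  by move=> mS; apply: (integrableS mB) => //; exact: measurableI.
move: A; apply: (dynkin_induction (@orthants_generate R n)).
- by move=> _ _ [a ->] [b ->]; rewrite orthantI; eexists; reflexivity.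
- by rewrite setIT; exact: int_open_box0.
- move=> _ [a ->].
  have -> : open_box l r `&` orthant a =
      open_box (\row_i Num.max (a ord0 i) (l ord0 i)) r.
    apply/seteqP; split=> x /=.
      move=> [xb xa] i; rewrite mxE gt_max xa /=; exact: xb.
    move=> xb; split=> i; have := xb i; rewrite mxE gt_max => /andP[/andP[h1 h2] h3] //.
    by rewrite h2.
  apply: int_open_box0 => x xb; apply: lrO => i; have := xb i.
  by rewrite mxE ge_max => /andP[/andP[_ ->]].
- move=> S mS S0.
  have : (\int[mu]_(x in (open_box l r `&` S) `|` (open_box l r `&` ~` S)) (w x)%:E = 0)%E.
    by rewrite -setIUr setUCr setIT; exact: int_open_box0.
  rewrite integral_setU_EFin.
  + by rewrite S0 add0e.
  + exact: measurableI.
  + by apply: measurableI => //; exact: measurableC.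
  + rewrite -setIUr setUCr setIT; apply/measurable_EFinP.
    exact: (measurable_int mu iw).
  + by apply/disj_setPS => x [[_ ?] [_ ?]].
- move=> F mF tF F0; rewrite setI_bigcupr integral_bigcup.
  + by apply: eseries0 => k _ _; exact: F0.
  + exact: trivIset_setIl.
  + by move=> k; exact: measurableI.
  + by rewrite -setI_bigcupr; apply: iS; exact: bigcup_measurable.
Qed.

Lemma ae_box0 (l r : V) :
  [set x : V | forall i, l ord0 i <= x ord0 i <= r ord0 i] `<=` Om ->
  ae_eq mu (open_box l r) (EFin \o w) (cst 0%E).
Proof.
move=> lrO.
have blO : open_box l r `<=` Om.
  by move=> x xb; apply: lrO => i; have /andP[/ltW-> /ltW->] := xb i.
apply: integral_ae_eq => //.
- exact: measurable_open_box.
- exact: open_box_integrable.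
- move=> E EB mE; rewrite integral0 -(setIidr EB).
  exact: int_subset_box0.
Qed.

(** The function vanishes almost everywhere on each of countably many boxes that
    cover [Om]. *)
Lemma fundamental_lemma : eq_on Om w 0.
Proof.
pose lo (p : 'rV[rat]_n * nat) : V := \row_i (ratr (p.1 ord0 i) - p.2.+1%:R^-1).
pose hi (p : 'rV[rat]_n * nat) : V := \row_i (ratr (p.1 ord0 i) + p.2.+1%:R^-1).
pose N (k : nat) : set V := if unpickle k is Some p then
  (if `[< closed_qcube p `<=` Om >] then [set x | open_box (lo p) (hi p) x /\ w x <> 0]
   else set0) else set0.
have N0 k : mu.-negligible (N k).
  rewrite /N; case: unpickle => [p|]; last exact: negligible_set0.
  case: asboolP => pO; last exact: negligible_set0.
  have H : ae_eq mu (open_box (lo p) (hi p)) (EFin \o w) (cst 0%E).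
    by apply: ae_box0 => x xp; apply: pO => i; have := xp i; rewrite !mxE.
  move: H; rewrite /ae_eq /almost_everywhere; apply: negligibleS.
  by move=> x /= [xb wx] H; apply: wx; have [] := H xb.
have := negligible_bigcup N0; apply: negligibleS.
move=> x /= /not_implyP[Ox wx].
have [p px pO] := qcube_base oOm Ox.
exists (pickle p) => //; rewrite /N pickleK asboolT//; split=> // i.
by have := px i; rewrite !mxE.
Qed.

End fundamental_lemma.

(** * Semi-inner products *)

Section semi_inner_product.
Variables (R : realType) (T : lmodType R).
Implicit Types (S : set T) (B : T -> T -> R).

Definition lin_closed S := forall (a : R) u v, S u -> S v -> S (a *: u + v).

Lemma lin_closed_sub S u v : lin_closed S -> S u -> S v -> S (u - v).
Proof.
move=> cS Su Sv; have -> : u - v = - 1 *: v + u by rewrite scaleN1r addrC.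
exact: cS.
Qed.

(** Linearity and positivity are asked on [S] only, because forms defined with
    integrals and chosen weak derivatives have them only on L^2 or H^1; the form
    need not be definite, because elements are identified almost everywhere. *)
Record semi_inner S B : Prop := SemiInner {
  semi_inner_closed : lin_closed S;
  semi_innerC : forall u v, B u v = B v u;
  semi_inner_linl : forall (a : R) u v w, S u -> S v -> S w ->
    B (a *: u + v) w = a * B u w + B v w;
  semi_inner_ge0 : forall u, S u -> 0 <= B u u
}.

Definition semi_norm B u := Num.sqrt (B u u).

Lemma semi_norm_ge0 B u : 0 <= semi_norm B u.
Proof. exact: sqrtr_ge0. Qed.

Section theory.
Variables (S : set T) (B : T -> T -> R).
Hypothesis SB : semi_inner S B.

Lemma semi_inner_linr (a : R) u v w : S u -> S v -> S w ->
  B w (a *: u + v) = a * B w u + B w v.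
Proof.
by move=> Su Sv Sw; rewrite !(semi_innerC SB w) (semi_inner_linl SB).
Qed.

Lemma semi_norm_sqr u : S u -> semi_norm B u ^+ 2 = B u u.
Proof. by move=> Su; rewrite sqr_sqrtr// (semi_inner_ge0 SB). Qed.

Lemma cauchy_schwarz u v : S u -> S v -> `|B u v| <= semi_norm B u * semi_norm B v.
Proof.
move=> Su Sv.
have quad t : 0 <= t ^+ 2 * B u u + 2 * t * B u v + B v v.
  have Sw := semi_inner_closed SB t Su Sv.
  have := semi_inner_ge0 SB Sw.
  rewrite (semi_inner_linl SB)// !semi_inner_linr// (semi_innerC SB v u).
  by congr (0 <= _); ring.
have Buu := semi_inner_ge0 SB Su; have Bvv := semi_inner_ge0 SB Sv.
rewrite -sqrtrM// -sqrtr_sqr ler_wsqrtr//.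
have [u0|u0] := eqVneq (B u u) 0.
  (* If B u v were nonzero, the affine polynomial would be -1 here. *)
  have := quad (- (B v v + 1) / (2 * B u v)).
  have [->|uv0] := eqVneq (B u v) 0; first by rewrite u0 expr0n mul0r.
  have -> : 2 * (- (B v v + 1) / (2 * B u v)) * B u v = - (B v v + 1) by field.
  by rewrite u0 mulr0 add0r => h; exfalso; lra.
(* The minimum of the quadratic polynomial. *)
have := quad (- B u v / B u u).
have -> : (- B u v / B u u) ^+ 2 * B u u + 2 * (- B u v / B u u) * B u v + B v v =
   (B u u * B v v - B u v ^+ 2) / B u u by field.
by rewrite pmulr_lge0 ?subr_ge0// invr_gt0 lt_def u0.
Qed.

Lemma semi_norm_triangle (a : R) u v : S u -> S v ->
  semi_norm B (a *: u + v) <= `|a| * semi_norm B u + semi_norm B v.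
Proof.
move=> Su Sv; have Sw := semi_inner_closed SB a Su Sv.
have [nu nv] := (semi_norm_ge0 B u, semi_norm_ge0 B v).
rewrite -(@ler_pXn2r _ 2) ?nnegrE ?semi_norm_ge0// ?addr_ge0 ?mulr_ge0//.
rewrite semi_norm_sqr// (semi_inner_linl SB)// !semi_inner_linr// (semi_innerC SB v u).
rewrite sqrrD exprMn real_normK ?num_real// !semi_norm_sqr//.
have -> : a * (a * B u u + B u v) + (a * B u v + B v v) =
  a ^+ 2 * B u u + (a * B u v) *+ 2 + B v v by ring.
rewrite lerD2r lerD2l lerMn2r /=.
by rewrite (le_trans (ler_norm _))// normrM -mulrA ler_wpM2l// cauchy_schwarz.
Qed.

End theory.

Lemma semi_inner_sum n S (B : 'I_n -> T -> T -> R) : lin_closed S ->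
  (forall i, semi_inner S (B i)) -> semi_inner S (fun u v => \sum_(i < n) B i u v).
Proof.
move=> cS SB; split=> //.
- by move=> u v; apply: eq_bigr => i _; exact: (semi_innerC (SB i)).
- move=> a u v w Su Sv Sw; rewrite mulr_sumr -big_split /=.
  by apply: eq_bigr => i _; exact: (semi_inner_linl (SB i)).
- by move=> u Su; apply: sumr_ge0 => i _; exact: (semi_inner_ge0 (SB i)).
Qed.

Lemma semi_norm_sum_ge n S (B : 'I_n -> T -> T -> R) i u :
  (forall i, semi_inner S (B i)) -> S u ->
  semi_norm (B i) u <= semi_norm (fun u v => \sum_(i < n) B i u v) u.
Proof.
move=> SB Su; rewrite ler_wsqrtr// (bigD1 i)//= lerDl.
by apply: sumr_ge0 => j _; exact: (semi_inner_ge0 (SB j)).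
Qed.

End semi_inner_product.

(** * The space L^2 *)

Section L2_theory.
Variables (R : realType) (d : nat) (Om : set 'rV[R]_d).
Hypothesis oOm : open Om.
Local Notation mu := (lebesgue_rV R d).
Local Notation V := 'rV[R]_d.
Implicit Types u v w : V -> R.

Let mOm : measurable Om := open_measurable_rV oOm.

Definition ip u v : R := \int[mu]_(x in Om) (u x * v x).

Lemma integrable_scale (a : R) u : mu.-integrable Om (EFin \o u) ->
  mu.-integrable Om (EFin \o (fun x => a * u x)).
Proof. by move=> iu; have := integrableZl mOm a iu. Qed.

Lemma integrable_add u v : mu.-integrable Om (EFin \o u) ->
  mu.-integrable Om (EFin \o v) -> mu.-integrable Om (EFin \o (fun x => u x + v x)).
Proof. by move=> iu iv; have := integrableD mOm iu iv. Qed.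

Lemma L2P u : L2 Om u <-> measurable_fun Om u /\
  mu.-integrable Om (EFin \o (fun x => u x ^+ 2)).
Proof.
split=> -[mfu iu]; split=> //.
  apply/integrableP; split; first by apply/measurable_EFinP; exact: measurable_funX.
  by under eq_integral do rewrite /= ger0_norm ?sqr_ge0//.
move/integrableP : iu => [_].
by under eq_integral do rewrite /= ger0_norm ?sqr_ge0//.
Qed.

Lemma L2_mul_integrable u v : L2 Om u -> L2 Om v ->
  mu.-integrable Om (EFin \o (fun x => u x * v x)).
Proof.
move=> /L2P[mfu iu] /L2P[mv iv].
apply: (le_integrable mOm _ _ (integrableD mOm iu iv)).
  by apply/measurable_EFinP; exact: measurable_funM.
move=> x _ /=; rewrite lee_fin [leRHS]ger0_norm ?addr_ge0 ?sqr_ge0// normrM.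
rewrite -[u x ^+ 2]real_normK ?num_real// -[v x ^+ 2]real_normK ?num_real//.
have := sqr_ge0 (`|u x| - `|v x|).
by have := normr_ge0 (u x); have := normr_ge0 (v x); nra.
Qed.

Lemma L2_lin : lin_closed (L2 Om).
Proof.
move=> a u v /[dup] Lu /L2P[mfu iu] /[dup] Lv /L2P[mv iv]; apply/L2P; split.
  apply: measurable_funD => //; exact: measurable_funM.
have i1 := integrable_scale (a ^+ 2) iu.
have i2 := integrable_scale (2 * a) (L2_mul_integrable Lu Lv).
have := integrable_add (integrable_add i1 i2) iv.
congr (_.-integrable _ _); apply/funext => x; rewrite /=; congr EFin.
by rewrite -[(a *: u + v) x]/(a * u x + v x); ring.
Qed.

Lemma ipC u v : ip u v = ip v u.
Proof. by rewrite /ip; under eq_Rintegral do rewrite mulrC. Qed.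

Lemma ip_sq u : ip u u = \int[mu]_(x in Om) (u x ^+ 2).
Proof. by apply: eq_Rintegral => x _; rewrite expr2. Qed.

Lemma ip_semi_inner : semi_inner (L2 Om) ip.
Proof.
split.
- exact: L2_lin.
- exact: ipC.
- move=> a u v w Lu Lv Lw.
  rewrite /ip -RintegralZl//; last exact: L2_mul_integrable.
  rewrite -RintegralD//.
  + by apply: eq_Rintegral => x _; rewrite -[(a *: u + v) x]/(a * u x + v x); ring.
  + by apply: integrable_scale; exact: L2_mul_integrable.
  + exact: L2_mul_integrable.
- by move=> u _; rewrite ip_sq; apply: Rintegral_ge0 => x _; exact: sqr_ge0.
Qed.

Lemma ip_eq_on u u' v : L2 Om u -> L2 Om u' -> L2 Om v -> eq_on Om u u' ->
  ip u v = ip u' v.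
Proof.
move=> [mfu _] [mfu' _] [mv _] uu'; congr fine; apply: ae_eq_integral => //.
- by apply/measurable_EFinP; exact: measurable_funM.
- by apply/measurable_EFinP; exact: measurable_funM.
- by move: uu'; apply: filterS => x + Ox => /(_ Ox) /= ->.
Qed.

Lemma ip_eq0 u : L2 Om u -> ip u u = 0 -> eq_on Om u 0.
Proof.
move=> /[dup] Lu /L2P[mfu iu] u0.
have H : ae_eq mu Om (EFin \o (fun x => u x ^+ 2)) (cst 0%E).
  apply/ae_eq_integral_abs => //.
    by apply/measurable_EFinP; exact: measurable_funX.
  under eq_integral do rewrite /= ger0_norm ?sqr_ge0//.
  move: u0; rewrite ip_sq /Rintegral => u0.
  by rewrite -[LHS]fineK ?u0//; exact: integrable_fin_num.
by move: H; apply: filterS => x + Ox => /(_ Ox) /= /eqP; rewrite eqe sqrf_eq0 => /eqP.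
Qed.

Lemma ip_sum n (u w : 'I_n -> V -> R) : (forall i, L2 Om (u i)) ->
  (forall i, L2 Om (w i)) ->
  \int[mu]_(x in Om) (\sum_(i < n) u i x * w i x) = \sum_(i < n) ip (u i) (w i).
Proof.
move=> Lu Lw.
have iuw i := L2_mul_integrable (Lu i) (Lw i).
rewrite /ip; elim: (index_enum _) => [|i s IH].
  rewrite big_nil; under eq_Rintegral do rewrite big_nil.
  by rewrite Rintegral_cst// mul0r.
have is_ : mu.-integrable Om (EFin \o (fun x => \sum_(j <- s) u j x * w j x)).
  have := integrable_sum mOm s (P := xpredT) (fun j _ => iuw j).
  by congr (_.-integrable _ _); apply/funext => x; rewrite /= sumEFin.
rewrite big_cons -IH -RintegralD//.
by apply: eq_Rintegral => x _; rewrite big_cons.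
Qed.

Lemma ip_suml n (u : 'I_n -> V -> R) v : (forall i, L2 Om (u i)) -> L2 Om v ->
  \int[mu]_(x in Om) ((\sum_(i < n) u i x) * v x) = \sum_(i < n) ip (u i) v.
Proof.
move=> Lu Lv; under eq_Rintegral do rewrite mulr_suml.
exact: (ip_sum (w := fun=> v)).
Qed.

End L2_theory.

(** * Test functions *)

Lemma continuous_mul_fun (R : realType) (T : topologicalType) (f g : T -> R) :
  continuous f -> continuous g -> continuous (fun x => f x * g x).
Proof. by move=> cf cg x; exact: (continuousM (cf x) (cg x)). Qed.

Lemma continuous_add_fun (R : realType) (T : topologicalType) (f g : T -> R) :
  continuous f -> continuous g -> continuous (fun x => f x + g x).
Proof. by move=> cf cg x; exact: (continuousD (cf x) (cg x)). Qed.

Section test_functions.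
Variables (R : realType) (d : nat) (Om : set 'rV[R]_d).
Hypothesis oOm : open Om.
Local Notation mu := (lebesgue_rV R d).
Local Notation V := 'rV[R]_d.
Implicit Types (phi psi u v w g h : V -> R).

Let mOm : measurable Om := open_measurable_rV oOm.

Lemma smooth_pderiv i phi : smooth phi -> smooth (pderiv i phi).
Proof. by move=> s t x; have := s (rcons t i) x; rewrite foldr_rcons. Qed.

Lemma smooth_differentiable phi x : smooth phi -> differentiable phi x.
Proof. by move=> s; exact: (s [::] x). Qed.

Lemma smooth_continuous phi : smooth phi -> continuous phi.
Proof. by move=> s x; apply: differentiable_continuous; exact: smooth_differentiable. Qed.

Lemma smooth_is_derive i phi x : smooth phi ->
  is_derive x (delta_mx ord0 i) phi (pderiv i phi x).
Proof. by move=> s; apply: derivableP; apply: diff_derivable; exact: smooth_differentiable. Qed.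

Lemma smooth_lin (a : R) phi psi : smooth phi -> smooth psi -> smooth (a *: phi + psi).
Proof.
move=> sphi spsi s.
have -> : foldr (@pderiv R d) (a *: phi + psi) s =
    a *: foldr (@pderiv R d) phi s + foldr (@pderiv R d) psi s.
  elim: s => //= i s ->; apply/funext => x; rewrite /pderiv.
  have dp : derivable (foldr (@pderiv R d) phi s) x (delta_mx ord0 i).
    by apply: diff_derivable; exact: sphi.
  have dq : derivable (foldr (@pderiv R d) psi s) x (delta_mx ord0 i).
    by apply: diff_derivable; exact: spsi.
  by rewrite (deriveD (@derivableZ _ _ _ _ a _ _ dp) dq) (@deriveZ _ _ _ _ a _ _ dp).
by move=> x; apply: differentiableD; [apply: differentiableZ|]; [exact: sphi|exact: spsi].
Qed.

Lemma test_function_pderiv i phi : test_function Om phi -> test_function Om (pderiv i phi).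
Proof.
move=> [s c k].
have sub : closure [set x | pderiv i phi x != 0] `<=` closure [set x | phi x != 0].
  have cl : closed (closure [set x | phi x != 0]) by exact: closed_closure.
  rewrite [X in _ `<=` X](closure_id _).1//; apply: closure_subset => x /= px.
  apply: contrapT => nx; move/eqP : px; apply.
  rewrite /pderiv (@near_eq_derive _ _ _ phi (cst 0)) ?derive_cst//.
  apply: filterS (open_nbhs_nbhs (conj (closed_openC cl) nx)) => y ny.
  by apply: contrapT => /eqP y0; apply: ny; exact: subset_closure.
split; first exact: smooth_pderiv.
  by apply: subclosed_compact sub => //; exact: closed_closure.
exact: subset_trans k.
Qed.

Lemma test_function0 : test_function Om 0.
Proof.
have e : [set x : V | (0 : V -> R) x != 0] = set0.
  by apply/seteqP; split=> x //=; rewrite eqxx.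
split; rewrite ?e ?closure0//; last exact: compact0.
exact: (@bumpy_smooth _ _ _ (@bumpy_cst R d 0)).
Qed.

Lemma test_function_lin : lin_closed (test_function Om).
Proof.
move=> a phi psi [s1 c1 k1] [s2 c2 k2].
have sub : closure [set x | (a *: phi + psi) x != 0] `<=`
    closure [set x | phi x != 0] `|` closure [set x | psi x != 0].
  rewrite -closureU; apply: closure_subset => x /= x0.
  have [p0|p0] := eqVneq (phi x) 0; last by left.
  right; apply: contra_neq x0 => q0.
  by rewrite -[LHS]/(a * phi x + psi x) p0 q0 mulr0 addr0.
split; first exact: smooth_lin.
  by apply: subclosed_compact sub; [exact: closed_closure|exact: compactU].
by apply: subset_trans sub _; rewrite subUset.
Qed.

Lemma test_function_cube phi : test_function Om phi ->
  exists K, forall x, ~ cube K x -> phi x = 0.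
Proof.
move=> [_ /compact_bounded [M [_ /(_ (M + 1)) H]] _].
exists (M + 1) => x nx; apply: contrapT => /eqP x0; apply: nx => i.
apply: le_trans (cube_norm x i) _; apply: H; first by rewrite ltrDl.
exact: subset_closure.
Qed.

Lemma test_function_out phi x : test_function Om phi -> ~ Om x -> phi x = 0.
Proof.
move=> [_ _ k] nx; apply: contrapT => /eqP x0; apply: nx; apply: k.
exact: subset_closure.
Qed.

Lemma cube_L2 u K : continuous u -> (forall x, ~ cube K x -> u x = 0) -> L2 Om u.
Proof.
move=> cu uK; apply/L2P; split.
  by apply: measurable_funTS; exact: continuous_measurable_rV.
apply: (integrableS measurableT) => //.
apply: (@continuous_cube_integrable _ _ _ K) => [x|x /uK ->]; last by rewrite expr0n.
exact: (continuous_mul_fun cu cu).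
Qed.

Lemma test_function_L2 phi : test_function Om phi -> L2 Om phi.
Proof.
move=> /[dup] t /test_function_cube[K H]; apply: (cube_L2 _ H).
by apply: smooth_continuous; case: t.
Qed.

(** As [G] vanishes outside of [Om], it can be integrated over the whole space,
    where there is no boundary term. *)
Lemma int_derive_Om0 i (F G : V -> R) K :
  (forall x, is_derive x (delta_mx ord0 i) F (G x)) -> continuous G ->
  (forall x, ~ cube K x -> F x = 0) -> (forall x, ~ Om x -> G x = 0) ->
  \int[mu]_(x in Om) G x = 0.
Proof.
move=> FG cG FK GO; rewrite /Rintegral.
have -> : (\int[mu]_(x in Om) (G x)%:E = \int[mu]_x (G x)%:E)%E.
  rewrite integral_mkcond; apply: eq_integral => x _; rewrite patchE.
  by case: ifPn => // /negP nx; rewrite GO// => /mem_set.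
by rewrite (int_pderiv0 FG cG FK).
Qed.

Lemma test_function_by_parts i phi psi : test_function Om phi -> test_function Om psi ->
  ip Om phi (pderiv i psi) + ip Om (pderiv i phi) psi = 0.
Proof.
move=> tp tq.
have [[sp _ _] [sq _ _]] := (tp, tq).
have [K pK] := test_function_cube tp.
have Lp := test_function_L2 tp; have Lq := test_function_L2 tq.
have Ldp := test_function_L2 (test_function_pderiv i tp).
have Ldq := test_function_L2 (test_function_pderiv i tq).
rewrite /ip -RintegralD//; [|exact: L2_mul_integrable|exact: L2_mul_integrable].
apply: (@int_derive_Om0 i (phi * psi) _ K).
- move=> x; have := is_deriveM (smooth_is_derive i x sp) (smooth_is_derive i x sq).
  by move=> H; apply: (is_derive_eq H); rewrite /GRing.scale /= (mulrC (psi x)).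
- have sdp := smooth_continuous (smooth_pderiv i sp).
  have sdq := smooth_continuous (smooth_pderiv i sq).
  have cp := smooth_continuous sp; have cq := smooth_continuous sq.
  by apply: continuous_add_fun; apply: continuous_mul_fun.
- by move=> x /pK p0; rewrite -[LHS]/(phi x * psi x) p0 mul0r.
- move=> x nx; rewrite (test_function_out tp nx) (test_function_out tq nx).
  by rewrite mul0r mulr0 addr0.
Qed.

Lemma test_function_weak_pderiv i phi : test_function Om phi ->
  weak_pderiv Om i phi (pderiv i phi).
Proof.
move=> tp psi tq.
by apply/eqP; rewrite -addr_eq0; apply/eqP; exact: test_function_by_parts.
Qed.

End test_functions.

(** * Weak derivatives and H^1 *)

Section weak_derivatives.
Variables (R : realType) (d : nat) (Om : set 'rV[R]_d).
Hypothesis oOm : open Om.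
Local Notation mu := (lebesgue_rV R d).
Local Notation V := 'rV[R]_d.
Implicit Types (phi psi u v w g h : V -> R).

Let mOm : measurable Om := open_measurable_rV oOm.
Let ipS := ip_semi_inner oOm.

Lemma eq_on_refl u : eq_on Om u u.
Proof. exact: ae_eq_refl. Qed.

Lemma eq_on_sym u v : eq_on Om u v -> eq_on Om v u.
Proof. exact: ae_eq_sym. Qed.

Lemma L2_0 : L2 Om 0.
Proof. exact/(test_function_L2 oOm)/test_function0. Qed.

(** This consequence of the fundamental lemma makes [wpd], which is a choice of
    a representative, linear up to equality almost everywhere. *)
Lemma weak_pderiv_unique i u g h : L2 Om g -> L2 Om h ->
  weak_pderiv Om i u g -> weak_pderiv Om i u h -> eq_on Om g h.
Proof.
move=> Lg Lh ug uh.
have L : L2 Om (- 1 *: h + g) by exact: L2_lin.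
have := fundamental_lemma oOm L; rewrite /eq_on.
have H phi : test_function Om phi -> \int[mu]_(x in Om) ((- 1 *: h + g) x * phi x) = 0.
  move=> tp; have Lp := test_function_L2 oOm tp.
  have := semi_inner_linl ipS (- 1) Lh Lg Lp.
  by rewrite /ip => ->; have := ug _ tp;
     rewrite (uh _ tp) => /oppr_inj ->; rewrite mulN1r addNr.
move=> /(_ H); apply: filterS => x + Ox => /(_ Ox).
rewrite -[(-1 *: h + g) x]/(- 1 * h x + g x) mulN1r addrC => /eqP.
by rewrite subr_eq0 => /eqP.
Qed.

Lemma weak_pderiv_lin i (a : R) u v g h : L2 Om u -> L2 Om v -> L2 Om g -> L2 Om h ->
  weak_pderiv Om i u g -> weak_pderiv Om i v h -> weak_pderiv Om i (a *: u + v) (a *: g + h).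
Proof.
move=> Lu Lv Lg Lh ug vh phi tp.
have Lp := test_function_L2 oOm tp.
have Ldp := test_function_L2 oOm (test_function_pderiv i tp).
have := semi_inner_linl ipS a Lu Lv Ldp; have := semi_inner_linl ipS a Lg Lh Lp.
by rewrite /ip => -> ->; rewrite ug// vh//; ring.
Qed.

Lemma weak_pderiv_eq_on i u v g : L2 Om u -> L2 Om v -> eq_on Om u v ->
  weak_pderiv Om i u g -> weak_pderiv Om i v g.
Proof.
move=> Lu Lv uv ug phi tp; rewrite -ug//.
apply: (ip_eq_on oOm) => //; first exact/(test_function_L2 oOm)/test_function_pderiv.
exact: eq_on_sym.
Qed.

Lemma sobolev1_L2 u : sobolev Om 1 u -> L2 Om u. Proof. by case. Qed.

Lemma wpdP i u : sobolev Om 1 u -> L2 Om (wpd Om i u) /\ weak_pderiv Om i u (wpd Om i u).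
Proof.
move=> [_ /(_ i) [g Lg ug]].
have := @xgetPex _ (0 : V -> R) [set g | L2 Om g /\ weak_pderiv Om i u g].
by apply; exists g.
Qed.

Lemma wpd_L2 i u : sobolev Om 1 u -> L2 Om (wpd Om i u).
Proof. by move=> /(wpdP i)[]. Qed.

Lemma wpd_unique i u g : sobolev Om 1 u -> L2 Om g -> weak_pderiv Om i u g ->
  eq_on Om (wpd Om i u) g.
Proof.
move=> /(wpdP i)[L w] Lg ug; exact: weak_pderiv_unique ug.
Qed.

Lemma sobolev1_lin : lin_closed (sobolev Om 1).
Proof.
move=> a u v Su Sv; split.
  by apply: (L2_lin oOm); exact: sobolev1_L2.
move=> i; have [Lu wu] := wpdP i Su; have [Lv wv] := wpdP i Sv.
exists (a *: wpd Om i u + wpd Om i v); first exact: L2_lin.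
by apply: weak_pderiv_lin => //; exact: sobolev1_L2.
Qed.

Lemma wpd_lin i (a : R) u v : sobolev Om 1 u -> sobolev Om 1 v ->
  eq_on Om (wpd Om i (a *: u + v)) (a *: wpd Om i u + wpd Om i v).
Proof.
move=> Su Sv; have [Lu wu] := wpdP i Su; have [Lv wv] := wpdP i Sv.
apply: wpd_unique; first exact: sobolev1_lin.
  exact: L2_lin.
by apply: weak_pderiv_lin => //; exact: sobolev1_L2.
Qed.

Lemma wpd_eq_on i u v : sobolev Om 1 u -> sobolev Om 1 v -> eq_on Om u v ->
  eq_on Om (wpd Om i u) (wpd Om i v).
Proof.
move=> Su Sv uv; have [Lu wu] := wpdP i Su.
apply: eq_on_sym; apply: wpd_unique => //.
by apply: weak_pderiv_eq_on wu => //; exact: sobolev1_L2.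
Qed.

Lemma test_function_sobolev1 phi : test_function Om phi -> sobolev Om 1 phi.
Proof.
move=> tp; split; first exact: test_function_L2.
move=> i; exists (pderiv i phi); last exact: test_function_weak_pderiv.
exact/(test_function_L2 oOm)/test_function_pderiv.
Qed.

Lemma wpd_test_function i phi : test_function Om phi ->
  eq_on Om (wpd Om i phi) (pderiv i phi).
Proof.
move=> tp; apply: wpd_unique; first exact: test_function_sobolev1.
  exact/(test_function_L2 oOm)/test_function_pderiv.
exact: test_function_weak_pderiv.
Qed.

Definition ip_wpd i u v := ip Om (wpd Om i u) (wpd Om i v).

Lemma ip_wpd_semi_inner i : semi_inner (sobolev Om 1) (ip_wpd i).
Proof.
split.
- exact: sobolev1_lin.
- by move=> u v; exact: ipC.
- move=> a u v w Su Sv Sw.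
  rewrite /ip_wpd (ip_eq_on oOm _ _ _ (wpd_lin i a Su Sv)).
  + by apply: (semi_inner_linl ipS); exact: wpd_L2.
  + by apply: wpd_L2; exact: sobolev1_lin.
  + by apply: (L2_lin oOm); exact: wpd_L2.
  + exact: wpd_L2.
- by move=> u Su; apply: (semi_inner_ge0 ipS); exact: wpd_L2.
Qed.

Lemma ip_wpd_linl i (a : R) u v q : sobolev Om 1 u -> sobolev Om 1 v -> L2 Om q ->
  ip Om (wpd Om i (a *: u + v)) q = a * ip Om (wpd Om i u) q + ip Om (wpd Om i v) q.
Proof.
move=> Su Sv Lq; rewrite (ip_eq_on oOm _ _ _ (wpd_lin i a Su Sv)) //.
+ by apply: (semi_inner_linl ipS) => //; exact: wpd_L2.
+ by apply: wpd_L2; exact: sobolev1_lin.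
+ by apply: (L2_lin oOm); exact: wpd_L2.
Qed.

Definition grad_form u v := \sum_(i < d) ip_wpd i u v.

Lemma grad_form_semi_inner : semi_inner (sobolev Om 1) grad_form.
Proof. by apply: semi_inner_sum => [|i]; [exact: sobolev1_lin|exact: ip_wpd_semi_inner]. Qed.

Definition h1_form u v := ip Om u v + grad_form u v.

Lemma h1_form_semi_inner : semi_inner (sobolev Om 1) h1_form.
Proof.
split.
- exact: sobolev1_lin.
- by move=> u v; rewrite /h1_form ipC (semi_innerC grad_form_semi_inner).
- move=> a u v w Su Sv Sw.
  rewrite /h1_form (semi_inner_linl grad_form_semi_inner)//.
  rewrite (semi_inner_linl ipS); [|exact: sobolev1_L2..].
  by rewrite mulrDr addrACA.
- move=> u Su; rewrite addr_ge0 ?(semi_inner_ge0 grad_form_semi_inner)//.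
  by apply: (semi_inner_ge0 ipS); exact: sobolev1_L2.
Qed.

Lemma sqnorm0E u : sqnorm Om 0 u = ip Om u u.
Proof. by rewrite /= addr0 ip_sq. Qed.

Lemma sqnorm1E u : sqnorm Om 1 u = h1_form u u.
Proof.
rewrite /= /h1_form /grad_form ip_sq; congr (_ + _); apply: eq_bigr => i _.
by rewrite addr0 /ip_wpd ip_sq.
Qed.

Lemma Hnorm1E u : Hnorm Om 1 u = semi_norm h1_form u.
Proof. by rewrite /Hnorm sqnorm1E. Qed.

Lemma H10_sobolev u : H10 Om u -> sobolev Om 1 u. Proof. by case. Qed.

Lemma H10_lin : lin_closed (H10 Om).
Proof.
move=> a u v [Su Du] [Sv Dv]; split; first exact: sobolev1_lin.
move=> e e0.
have e1 : 0 < e / (2 * (`|a| + 1)) by rewrite divr_gt0// mulr_gt0// ltr_wpDl.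
have e2 : 0 < e / 2 by rewrite divr_gt0.
have [p tp hp] := Du _ e1; have [q tq hq] := Dv _ e2.
have Sp := test_function_sobolev1 tp; have Sq := test_function_sobolev1 tq.
exists (a *: p + q); first exact: test_function_lin.
have -> : a *: u + v - (a *: p + q) = a *: (u - p) + (v - q).
  by rewrite scalerBr opprD addrACA.
have Sup : sobolev Om 1 (u - p).
  exact: (lin_closed_sub sobolev1_lin).
have Svq : sobolev Om 1 (v - q).
  exact: (lin_closed_sub sobolev1_lin).
rewrite Hnorm1E; apply: le_lt_trans (semi_norm_triangle h1_form_semi_inner a Sup Svq) _.
move: hp hq; rewrite !Hnorm1E => hp hq.
rewrite [e]splitr ler_ltD//.
apply: le_trans (ler_wpM2l (normr_ge0 a) (ltW hp)) _.
rewrite mulrCA ler_pM2l// ler_pdivrMr ?mulr_gt0 ?ltr_wpDl//.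
by rewrite mulrA mulVf// mul1r lerDl.
Qed.

Lemma test_function_H10 phi : test_function Om phi -> H10 Om phi.
Proof.
move=> tp; split; first exact: test_function_sobolev1.
move=> e e0; exists phi => //; rewrite subrr Hnorm1E.
have S0 : sobolev Om 1 0 by apply: test_function_sobolev1; exact: test_function0.
have := semi_inner_linl h1_form_semi_inner (- 1) S0 S0 S0.
rewrite scaler0 addr0 mulN1r addNr => h.
by rewrite /semi_norm h sqrtr0.
Qed.

(** Both sides are continuous in [w] for the H^1 norm, by the Cauchy-Schwarz
    inequality, so that density of the test functions applies. *)
Lemma H10_density (G : 'I_d -> V -> R) f w : (forall j, L2 Om (G j)) -> L2 Om f ->
  (forall phi, test_function Om phi ->
     \sum_(j < d) ip Om (G j) (pderiv j phi) = ip Om f phi) ->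
  H10 Om w -> \sum_(j < d) ip Om (G j) (wpd Om j w) = ip Om f w.
Proof.
move=> LG Lf Gf [Sw Dw].
pose C := \sum_(j < d) semi_norm (ip Om) (G j) + semi_norm (ip Om) f.
have C0 : 0 <= C by rewrite addr_ge0 ?semi_norm_ge0// sumr_ge0// => j _; exact: semi_norm_ge0.
apply/eqP; rewrite -subr_eq0 -normr_le0; apply/ler_addgt0Pr => e e0; rewrite add0r.
have e1 : 0 < e / (C + 1) by rewrite divr_gt0// ltr_wpDl.
have [p tp hp] := Dw _ e1.
have Sp := test_function_sobolev1 tp.
have Swp : sobolev Om 1 (w - p) by exact: (lin_closed_sub sobolev1_lin).
have -> : \sum_(j < d) ip Om (G j) (wpd Om j w) - ip Om f w =
    \sum_(j < d) ip Om (G j) (wpd Om j (w - p)) - ip Om f (w - p).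
  have e2 : ip Om f w = ip Om f (w - p) + ip Om f p.
    have := semi_inner_linr ipS 1 (sobolev1_L2 Swp) (sobolev1_L2 Sp) Lf.
    by rewrite scale1r subrK => ->; rewrite mul1r.
  have e3 j : ip Om (G j) (wpd Om j w) =
      ip Om (G j) (wpd Om j (w - p)) + ip Om (G j) (pderiv j p).
    have := ip_wpd_linl j 1 Swp Sp (LG j).
    rewrite scale1r subrK ipC => ->; rewrite mul1r; congr (_ + _); first exact: ipC.
    rewrite (ip_eq_on oOm _ _ _ (wpd_test_function j tp)) 1?ipC//.
    - exact: wpd_L2.
    - exact/(test_function_L2 oOm)/test_function_pderiv.
  have e4 : \sum_(j < d) ip Om (G j) (wpd Om j w) =
      \sum_(j < d) ip Om (G j) (wpd Om j (w - p)) + ip Om f p.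
    by rewrite -(Gf p tp) -big_split /=; apply: eq_bigr => j _; exact: e3.
  apply: (eq_trans (congr2 (fun x y => x - y) e4 e2)).
  by rewrite opprD addrACA subrr addr0.
have hn u : sobolev Om 1 u -> semi_norm (ip Om) u <= semi_norm h1_form u.
  move=> Su; rewrite ler_wsqrtr// lerDl.
  exact: (semi_inner_ge0 grad_form_semi_inner).
have hg j u : sobolev Om 1 u -> semi_norm (ip Om) (wpd Om j u) <= semi_norm h1_form u.
  move=> Su; rewrite ler_wsqrtr// /h1_form /grad_form (bigD1 j)//= addrCA lerDl addr_ge0//.
    by apply: (semi_inner_ge0 ipS); exact: sobolev1_L2.
  by apply: sumr_ge0 => k _; exact: (semi_inner_ge0 (ip_wpd_semi_inner k)).
have : `|\sum_(j < d) ip Om (G j) (wpd Om j (w - p)) - ip Om f (w - p)| <=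
   C * semi_norm h1_form (w - p).
  apply: le_trans (ler_normB _ _) _; rewrite mulrDl lerD//.
    apply: le_trans (ler_norm_sum _ _ _) _; rewrite mulr_suml; apply: ler_sum => j _.
    apply: le_trans (cauchy_schwarz ipS (LG j) (wpd_L2 j Swp)) _.
    by rewrite ler_wpM2l ?semi_norm_ge0// hg.
  apply: le_trans (cauchy_schwarz ipS Lf (sobolev1_L2 Swp)) _.
  by rewrite ler_wpM2l ?semi_norm_ge0// hn.
move=> /le_trans; apply; rewrite Hnorm1E in hp.
apply: le_trans (ler_wpM2l C0 (ltW hp)) _.
by rewrite mulrCA ger_pMr// ler_pdivrMr ?mul1r ?lerDl// ltr_wpDl.
Qed.

(** The integral of the i-th derivative of x_i * phi ^ 2 vanishes, that is,
    (phi, phi) + 2 (phi, g) = 0 with g = x_i d_i phi; and phi + 2 g has a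
    nonnegative square. *)
Lemma poincare_test (i : 'I_d) K phi : (forall x, Om x -> `|x ord0 i| <= K) ->
  test_function Om phi -> semi_norm (ip Om) phi <= 2 * `|K| * semi_norm (ip Om) (pderiv i phi).
Proof.
move=> OK tp.
have [sp _ _] := tp.
have tdp := test_function_pderiv i tp; have [sdp _ _] := tdp.
have Lp := test_function_L2 oOm tp; have Ldp := test_function_L2 oOm tdp.
pose xi : V -> R := fun x => x ord0 i.
have cxi : continuous xi by move=> x; exact: coord_continuous.
have cp := smooth_continuous sp; have cdp := smooth_continuous sdp.
pose g : V -> R := fun x => xi x * pderiv i phi x.
have cg : continuous g by exact: continuous_mul_fun.
have Lg : L2 Om g.
  have [K' H] := test_function_cube tdp.
  by apply: (cube_L2 oOm cg (K := K')) => x /H; rewrite /g => ->; rewrite mulr0.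
have gE : ip Om g g <= `|K| ^+ 2 * ip Om (pderiv i phi) (pderiv i phi).
  rewrite !ip_sq -RintegralZl//; last by have [] := (L2P _ _).1 Ldp.
  apply: le_Rintegral => //.
  - by have [] := (L2P _ _).1 Lg.
  - by apply: integrable_scale => //; have [] := (L2P _ _).1 Ldp.
  - move=> x Ox; rewrite /g exprMn ler_wpM2r ?sqr_ge0//.
    rewrite -[xi x ^+ 2]real_normK ?num_real// ler_sqr ?nnegrE//.
    by rewrite (le_trans (OK x Ox))// ler_norm.
have pg : ip Om phi phi + 2 * ip Om phi g = 0.
  rewrite /ip -RintegralZl//; last exact: L2_mul_integrable.
  rewrite -RintegralD//; last 2 first.
  - exact: L2_mul_integrable.
  - by apply: integrable_scale => //; exact: L2_mul_integrable.
  have [K' H] := test_function_cube tp.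
  apply: (@int_derive_Om0 _ _ _ i (xi * (phi * phi)) _ K').
  - move=> x; have d1 := is_derive_coord x (delta_mx ord0 i) i.
    have d2 := smooth_is_derive i x sp.
    have := is_deriveM d1 (is_deriveM d2 d2).
    move=> h; apply: (is_derive_eq h).
    by rewrite mxE !eqxx /GRing.scale /= /g /xi fctE; ring.
  - apply: continuous_add_fun; first exact: continuous_mul_fun.
    by apply: continuous_mul_fun; [exact: cst_continuous|exact: continuous_mul_fun].
  - by move=> x /H p0; rewrite -[LHS]/(xi x * (phi x * phi x)) p0 !mulr0.
  - by move=> x nx; rewrite (test_function_out tp nx) !mul0r mulr0 addr0.
have sq : 0 <= ip Om (2 *: g + phi) (2 *: g + phi).
  by apply: (semi_inner_ge0 ipS); exact: L2_lin.
have pp : ip Om phi phi <= 4 * ip Om g g.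
  move: sq; have Lgp := L2_lin oOm 2 Lg Lp.
  rewrite (semi_inner_linl ipS)// !(semi_inner_linr ipS)// (ipC _ g phi).
  by move: pg; lra.
have nn := semi_norm_ge0 (ip Om).
rewrite -(@ler_pXn2r _ 2) ?nnegrE ?mulr_ge0//.
rewrite exprMn !(semi_norm_sqr ipS)// exprMn.
by apply: le_trans pp _; move: gE; lra.
Qed.

Lemma poincare (i : 'I_d) K u : (forall x, Om x -> `|x ord0 i| <= K) ->
  H10 Om u -> semi_norm (ip Om) u <= 2 * `|K| * semi_norm grad_form u.
Proof.
move=> OK [Su Du].
have nn := semi_norm_ge0.
apply/ler_addgt0Pr => e e0.
have K1 : 0 < 1 + 2 * `|K| by rewrite ltr_wpDr// mulr_ge0.
have e1 : 0 < e / (1 + 2 * `|K|) by rewrite divr_gt0.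
have [p tp hp] := Du _ e1; rewrite Hnorm1E in hp.
have Sp := test_function_sobolev1 tp.
have Sup : sobolev Om 1 (u - p) by exact: (lin_closed_sub sobolev1_lin).
have hn v : sobolev Om 1 v -> semi_norm (ip Om) v <= semi_norm h1_form v.
  move=> Sv; rewrite ler_wsqrtr// lerDl.
  exact: (semi_inner_ge0 grad_form_semi_inner).
have hg v : sobolev Om 1 v -> semi_norm grad_form v <= semi_norm h1_form v.
  move=> Sv; rewrite ler_wsqrtr// lerDr.
  by apply: (semi_inner_ge0 ipS); exact: sobolev1_L2.
have h1 : semi_norm (ip Om) u <= semi_norm (ip Om) (u - p) + semi_norm (ip Om) p.
  have := semi_norm_triangle ipS 1 (sobolev1_L2 Sup) (sobolev1_L2 Sp).
  by rewrite scale1r subrK normr1 mul1r.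
have h2 := poincare_test OK tp.
have h3 : semi_norm (ip Om) (pderiv i p) <= semi_norm grad_form p.
  have -> : semi_norm (ip Om) (pderiv i p) = semi_norm (ip_wpd i) p.
    have Lw := wpd_L2 i Sp.
    have Ld : L2 Om (pderiv i p) by exact/(test_function_L2 oOm)/test_function_pderiv.
    rewrite /semi_norm /ip_wpd (ip_eq_on oOm Lw Ld Lw (wpd_test_function i tp)) ipC.
    by rewrite (ip_eq_on oOm Lw Ld Ld (wpd_test_function i tp)).
  exact: (semi_norm_sum_ge _ (fun j => ip_wpd_semi_inner j) Sp).
have h4 : semi_norm grad_form p <= semi_norm grad_form (u - p) + semi_norm grad_form u.
  have := semi_norm_triangle grad_form_semi_inner (- 1) Sup Su.
  by rewrite normrN1 mul1r scaleN1r opprB subrK.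
have h5 := hn _ Sup; have h6 := hg _ Sup.
have h7 : (1 + 2 * `|K|) * semi_norm h1_form (u - p) <= e.
  by rewrite mulrC -ler_pdivlMr// ltW.
have k0 : 0 <= 2 * `|K| by rewrite mulr_ge0.
have h8 := ler_wpM2l k0 (le_trans h3 (le_trans h4 (lerD h6 (lexx _)))).
apply: le_trans h1 _; apply: le_trans (lerD h5 (le_trans h2 h8)) _.
by rewrite mulrDr addrA addrC lerD2l -{1}[semi_norm h1_form _]mul1r -mulrDl.
Qed.

End weak_derivatives.

(** * The discrete Stokes projection *)

Section linear_algebra.
Variable R : realType.

(** A system is solvable when its right-hand side vanishes on the kernel, and
    the pseudo-inverse then gives a solution that is linear in it. *)
Lemma solve_row N (K : 'M[R]_N) (r : 'rV[R]_N) :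
  (forall z : 'cV[R]_N, K *m z = 0 -> r *m z = 0) -> r *m pinvmx K *m K = r.
Proof.
move=> Kr; apply: mulmxKpV; rewrite submxE; apply/eqP/matrixP => i j; rewrite [RHS]mxE.
have /Kr /matrixP /(_ i ord0) : K *m col j (cokermx K) = 0.
  by rewrite colE mulmxA mulmx_coker mul0mx.
by rewrite colE mulmxA -colE [LHS]mxE [RHS]mxE.
Qed.

Lemma linear_on_sum (T : lmodType R) (S : set T) (f : T -> R) : S 0 -> lin_closed S ->
  (forall (a : R) u v, S u -> S v -> f (a *: u + v) = a * f u + f v) ->
  forall n (c : 'I_n -> R) (x : 'I_n -> T), (forall i, S (x i)) ->
  S (\sum_(i < n) c i *: x i) /\
  f (\sum_(i < n) c i *: x i) = \sum_(i < n) c i * f (x i).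
Proof.
move=> S0 Sc fl n c x Sx; elim: (index_enum _) => [|i s [IH1 IH2]].
  rewrite !big_nil; split=> //.
  have := fl 1 0 0 S0 S0; rewrite scaler0 addr0 mul1r => /eqP.
  by rewrite -subr_eq subrr eq_sym => /eqP.
by rewrite !big_cons fl// IH2; split=> //; exact: Sc.
Qed.

End linear_algebra.

Section saddle.
Variables (R : realType) (T Q : lmodType R) (S : set T) (SQ : set Q).
Variables (a : T -> T -> R) (b : T -> Q -> R).
Hypotheses (S0 : S 0) (aS : semi_inner S a) (SQ0 : SQ 0) (SQc : lin_closed SQ).
Hypothesis blinl : forall (k : R) u v q, S u -> S v -> SQ q ->
  b (k *: u + v) q = k * b u q + b v q.
Hypothesis blinr : forall (k : R) p q v, SQ p -> SQ q -> S v ->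
  b v (k *: p + q) = k * b v p + b v q.
Variables (n m : nat) (x : 'I_n -> T) (y : 'I_m -> Q).
Hypotheses (Sx : forall i, S (x i)) (Sy : forall i, SQ (y i)).

Let K : 'M[R]_(n + m) := block_mx
  (\matrix_(i, j) a (x i) (x j)) (\matrix_(i, k) b (x i) (y k))
  (\matrix_(k, j) - b (x j) (y k)) 0.
Let rhs v : 'rV[R]_(n + m) := row_mx (\row_j a v (x j)) (\row_k b v (y k)).
Let coef v : 'rV[R]_(n + m) := rhs v *m pinvmx K.

(** The components of the solution of the saddle point problem with data [a v]
    and [b v].  The pseudo-inverse makes them linear in [v]. *)
Definition saddle_fst v : T := \sum_(i < n) lsubmx (coef v) ord0 i *: x i.
Definition saddle_snd v : Q := \sum_(k < m) rsubmx (coef v) ord0 k *: y k.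

Let suma (c : 'I_n -> R) w : S w ->
  a (\sum_(i < n) c i *: x i) w = \sum_(i < n) c i * a (x i) w.
Proof.
move=> Sw; apply: (linear_on_sum (f := a^~ w) S0 (semi_inner_closed aS) _ c Sx).2.
by move=> k u v Su Sv; exact: (semi_inner_linl aS).
Qed.

Let sumbl (c : 'I_n -> R) q : SQ q ->
  b (\sum_(i < n) c i *: x i) q = \sum_(i < n) c i * b (x i) q.
Proof.
move=> Sq; apply: (linear_on_sum (f := b^~ q) S0 (semi_inner_closed aS) _ c Sx).2.
by move=> k u v Su Sv; exact: blinl.
Qed.

Let sumbr (c : 'I_m -> R) v : S v ->
  b v (\sum_(k < m) c k *: y k) = \sum_(k < m) c k * b v (y k).
Proof.
move=> Sv; apply: (linear_on_sum (f := b v) SQ0 SQc _ c Sy).2.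
by move=> k p q Sp Sq; exact: blinr.
Qed.

Lemma saddle_sum_in (c : 'I_n -> R) : S (\sum_(i < n) c i *: x i).
Proof.
elim: (index_enum _) => [|i s IH]; first by rewrite big_nil.
by rewrite big_cons; exact: (semi_inner_closed aS).
Qed.

Lemma saddle_sum_inQ (c : 'I_m -> R) : SQ (\sum_(i < m) c i *: y i).
Proof.
elim: (index_enum _) => [|i s IH]; first by rewrite big_nil.
by rewrite big_cons; exact: SQc.
Qed.

(** The generating families need not be free, so that the matrix of the system
    may be singular; the system is solvable as soon as the homogeneous solutions
    are invisible to the forms. *)
Lemma saddle_solution v : S v ->
  (forall (c : 'I_n -> R) (q : 'I_m -> R),
    let u := \sum_(i < n) c i *: x i in let p := \sum_(k < m) q k *: y k in
    (forall j, a u (x j) = b (x j) p) -> (forall k, b u (y k) = 0) ->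
    a v u = b v p) ->
  (forall j, a (saddle_fst v) (x j) - b (x j) (saddle_snd v) = a v (x j)) /\
  (forall k, b (saddle_fst v) (y k) = b v (y k)).
Proof.
move=> Sv hom.
have cK : coef v *m K = rhs v.
  apply: solve_row => z Kz.
  set z1 := usubmx z; set z2 := dsubmx z.
  have : K *m col_mx z1 z2 = 0 by rewrite vsubmxK.
  rewrite mul_block_col -col_mx0 => /eq_col_mx[/colP e1 /colP e2].
  have E1 i : \sum_j a (x i) (x j) * z1 j ord0 + \sum_k b (x i) (y k) * z2 k ord0 = 0.
    have := e1 i; rewrite mxE [X in X + _]mxE [X in _ + X]mxE [RHS]mxE => h; rewrite -[RHS]h.
    by congr (_ + _); apply: eq_bigr => ? _; congr (_ * _); rewrite mxE.
  have E2 k : \sum_j b (x j) (y k) * z1 j ord0 = 0.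
    have := e2 k; rewrite mxE [X in X + _]mxE mul0mx !mxE addr0 => /eqP.
    under eq_bigr do rewrite mxE mulNr.
    by rewrite sumrN oppr_eq0 => /eqP.
  have := hom (fun j => z1 j ord0) (fun k => - z2 k ord0).
  have H1 : forall j, a (\sum_(i < n) z1 i ord0 *: x i) (x j) =
      b (x j) (\sum_(k < m) - z2 k ord0 *: y k).
    move=> j; rewrite suma// sumbr//; apply/eqP; rewrite -subr_eq0 -sumrN; apply/eqP.
    rewrite -[RHS](E1 j); congr (_ + _); apply: eq_bigr => i _.
      by rewrite mulrC (semi_innerC aS).
    by rewrite mulNr opprK mulrC.
  have H2 : forall k, b (\sum_(i < n) z1 i ord0 *: x i) (y k) = 0.
    by move=> k; rewrite sumbl// -[RHS](E2 k); apply: eq_bigr => i _; rewrite mulrC.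
  move=> /(_ H1 H2); rewrite (semi_innerC aS) suma// sumbr// => h.
  rewrite -[z]vsubmxK mul_row_col; apply/matrixP => i j; rewrite !ord1 mxE.
  apply/eqP; rewrite [X in _ == X]mxE addr_eq0; apply/eqP.
  rewrite [LHS]mxE [in RHS]mxE -sumrN; apply: eq_trans (eq_trans h _).
    by apply: eq_bigr => l _; rewrite mxE (semi_innerC aS) mulrC.
  by apply: eq_bigr => l _; rewrite mulNr mulrC; congr (- (_ * _)); rewrite mxE.
have Sf : S (saddle_fst v) by exact: saddle_sum_in.
have Sg : SQ (saddle_snd v) by exact: saddle_sum_inQ.
move: cK; rewrite -[coef v]hsubmxK mul_row_block => /eq_row_mx[/rowP f1 /rowP f2].
split=> j.
  have := f1 j; rewrite mxE [X in X + _]mxE [X in _ + X]mxE [RHS]mxE => <-.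
  rewrite /saddle_fst suma// /saddle_snd sumbr// -sumrN; congr (_ + _); apply: eq_bigr => i _.
    by congr (_ * _); rewrite mxE.
  by rewrite -mulrN; congr (_ * _); rewrite mxE.
have := f2 j; rewrite mulmx0 addr0 mxE [RHS]mxE => <-.
by rewrite /saddle_fst sumbl//; apply: eq_bigr => i _; congr (_ * _); rewrite mxE.
Qed.

Lemma saddle_lin (k : R) u v : S u -> S v ->
  saddle_fst (k *: u + v) = k *: saddle_fst u + saddle_fst v.
Proof.
move=> Su Sv.
have cE : coef (k *: u + v) = k *: coef u + coef v.
  rewrite /coef scalemxAl -mulmxDl; congr (_ *m _).
  rewrite /rhs scale_row_mx add_row_mx; congr row_mx; apply/rowP => i; rewrite !mxE.
    exact: (semi_inner_linl aS).
  exact: blinl.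
rewrite /saddle_fst cE scaler_sumr -big_split /=; apply: eq_bigr => i _.
by rewrite !mxE scalerDl scalerA.
Qed.

Lemma saddle_ext u v : (forall j, a u (x j) = a v (x j)) ->
  (forall k, b u (y k) = b v (y k)) -> saddle_fst u = saddle_fst v.
Proof.
move=> e1 e2; rewrite /saddle_fst /coef (_ : rhs u = rhs v)//.
by congr row_mx; apply/rowP => i; rewrite !mxE.
Qed.

End saddle.

(** * Vector fields *)

Lemma semi_inner_sub (R : realType) (T : lmodType R) (S S' : set T) B :
  semi_inner S B -> lin_closed S' -> S' `<=` S -> semi_inner S' B.
Proof.
move=> SB cS' sub; split=> [|u v|a u v w Su Sv Sw|u Su].
- exact: cS'.
- exact: (semi_innerC SB).
- by apply: (semi_inner_linl SB); exact: sub.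
- by apply: (semi_inner_ge0 SB); exact: sub.
Qed.

Section vector_fields.
Variables (R : realType) (d : nat) (Om : set 'rV[R]_d).
Hypothesis oOm : open Om.
Local Notation mu := (lebesgue_rV R d).
Local Notation V := 'rV[R]_d.
Implicit Types (v w u psi : 'I_d -> V -> R) (p q theta : V -> R).

Let mOm : measurable Om := open_measurable_rV oOm.
Let ipS := ip_semi_inner oOm.

Definition vip v w := \sum_(i < d) ip Om (v i) (w i).
Definition vgrad v w := \sum_(i < d) grad_form Om (v i) (w i).
Definition div_form v q := \sum_(i < d) ip Om (wpd Om i (v i)) q.

Lemma semi_inner_comp n (S : set (V -> R)) B (i : 'I_n) : semi_inner S B ->
  semi_inner [set v : 'I_n -> V -> R | forall i, S (v i)]
    (fun f g => B (f i) (g i)).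
Proof.
move=> SB; split.
- by move=> a u v Su Sv j; apply: (semi_inner_closed SB); [exact: Su|exact: Sv].
- by move=> u v; exact: (semi_innerC SB).
- by move=> a u v w Su Sv Sw; exact: (semi_inner_linl SB).
- by move=> u Su; exact: (semi_inner_ge0 SB).
Qed.

Lemma vip_semi_inner : semi_inner (vL2 Om) vip.
Proof.
apply: semi_inner_sum => [a u v Su Sv i|i]; last exact: semi_inner_comp ipS.
by apply: (L2_lin oOm); [exact: Su|exact: Sv].
Qed.

Lemma vgrad_semi_inner : semi_inner (vsobolev Om 1) vgrad.
Proof.
apply: semi_inner_sum => [a u v Su Sv i|i].
  by apply: (sobolev1_lin oOm); [exact: Su|exact: Sv].
exact: semi_inner_comp (grad_form_semi_inner oOm).
Qed.

Lemma vsobolev1_L2 v : vsobolev Om 1 v -> vL2 Om v.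
Proof. by move=> Sv i; exact: sobolev1_L2. Qed.

Lemma vH10_sobolev v : vH10 Om v -> vsobolev Om 1 v.
Proof. by move=> Sv i; exact: H10_sobolev. Qed.

Lemma vH10_lin : lin_closed (vH10 Om).
Proof. by move=> a u v Su Sv i; apply: (H10_lin oOm); [exact: Su|exact: Sv]. Qed.

Lemma vH10_0 : vH10 Om 0.
Proof. by move=> i; apply: (test_function_H10 oOm); exact: test_function0. Qed.

Lemma vgrad_H10 : semi_inner (vH10 Om) vgrad.
Proof.
exact: (semi_inner_sub vgrad_semi_inner vH10_lin vH10_sobolev).
Qed.

Lemma div_form_linl (a : R) u v q : vsobolev Om 1 u -> vsobolev Om 1 v -> L2 Om q ->
  div_form (a *: u + v) q = a * div_form u q + div_form v q.
Proof.
move=> Su Sv Lq; rewrite /div_form mulr_sumr -big_split /=; apply: eq_bigr => i _.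
exact: (ip_wpd_linl oOm).
Qed.

Lemma div_form_linr (a : R) p q v : L2 Om p -> L2 Om q -> vsobolev Om 1 v ->
  div_form v (a *: p + q) = a * div_form v p + div_form v q.
Proof.
move=> Lp Lq Sv; rewrite /div_form mulr_sumr -big_split /=; apply: eq_bigr => i _.
by apply: (semi_inner_linr ipS) => //; exact: wpd_L2.
Qed.

Lemma div_formE v q : vsobolev Om 1 v -> L2 Om q ->
  \int[mu]_(x in Om) (divergence Om v x * q x) = div_form v q.
Proof.
by move=> Sv Lq; apply: (ip_suml oOm) => // i; exact: wpd_L2.
Qed.

Lemma div_form_le v q : vsobolev Om 1 v -> L2 Om q ->
  `|div_form v q| <= d%:R * semi_norm vgrad v * semi_norm (ip Om) q.
Proof.
move=> Sv Lq; apply: le_trans (ler_norm_sum _ _ _) _.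
have -> : d%:R * semi_norm vgrad v * semi_norm (ip Om) q =
    \sum_(i < d) semi_norm vgrad v * semi_norm (ip Om) q.
  by rewrite sumr_const card_ord -mulrA mulr_natl.
apply: ler_sum => i _.
apply: le_trans (cauchy_schwarz ipS (wpd_L2 i (Sv i)) Lq) _.
rewrite ler_wpM2r ?semi_norm_ge0//.
apply: (@le_trans _ _ (semi_norm (grad_form Om) (v i))).
  exact: (semi_norm_sum_ge i (fun j => ip_wpd_semi_inner oOm j) (Sv i)).
have := @semi_norm_sum_ge _ _ d (vsobolev Om 1)
  (fun i v w => grad_form Om (v i) (w i)) i v _ Sv.
apply => j; exact: semi_inner_comp (grad_form_semi_inner oOm).
Qed.

Lemma vHnorm0E v : vHnorm Om 0 v = semi_norm vip v.
Proof.
by rewrite /vHnorm /semi_norm; congr Num.sqrt; apply: eq_bigr => i _; rewrite sqnorm0E.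
Qed.

Lemma vHnorm1E v : vHnorm Om 1 v = Num.sqrt (vip v v + vgrad v v).
Proof.
rewrite /vHnorm; congr Num.sqrt; rewrite -big_split; apply: eq_bigr => i _.
exact: sqnorm1E.
Qed.

Lemma vgrad_le_vHnorm1 v : vsobolev Om 1 v -> semi_norm vgrad v <= vHnorm Om 1 v.
Proof.
move=> Sv; rewrite vHnorm1E ler_wsqrtr// lerDr.
by apply: (semi_inner_ge0 vip_semi_inner); exact: vsobolev1_L2.
Qed.

Lemma veq_refl v : veq Om v v. Proof. by move=> i; exact: eq_on_refl. Qed.

Lemma vgrad_eq u v w : vsobolev Om 1 u -> vsobolev Om 1 v -> vsobolev Om 1 w ->
  veq Om u v -> vgrad u w = vgrad v w.
Proof.
move=> Su Sv Sw uv; apply: eq_bigr => i _; apply: eq_bigr => j _.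
apply: (ip_eq_on oOm); [exact: wpd_L2..|].
exact: (wpd_eq_on oOm).
Qed.

Lemma div_form_eq u v q : vsobolev Om 1 u -> vsobolev Om 1 v -> L2 Om q ->
  veq Om u v -> div_form u q = div_form v q.
Proof.
move=> Su Sv Lq uv; apply: eq_bigr => i _.
apply: (ip_eq_on oOm) => //; [exact: wpd_L2..|].
exact: (wpd_eq_on oOm).
Qed.

Lemma div_form_eqr v p q : vsobolev Om 1 v -> L2 Om p -> L2 Om q ->
  eq_on Om p q -> div_form v p = div_form v q.
Proof.
move=> Sv Lp Lq pq; apply: eq_bigr => i _; rewrite !(ipC _ (wpd _ _ _)).
by apply: (ip_eq_on oOm) => //; exact: wpd_L2.
Qed.

(** By Poincare's inequality the gradient determines a field of H^1_0. *)
Lemma vgrad_eq0 (i : 'I_d) K v : (forall x, Om x -> `|x ord0 i| <= K) ->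
  vH10 Om v -> vgrad v v = 0 -> veq Om v 0.
Proof.
move=> OK Hv v0 j; apply: (ip_eq0 oOm); first exact/sobolev1_L2/H10_sobolev.
have g0 : grad_form Om (v j) (v j) = 0.
  have g k : 0 <= grad_form Om (v k) (v k).
    by apply: (semi_inner_ge0 (grad_form_semi_inner oOm)); exact: H10_sobolev.
  have := @psumr_eq0P _ _ xpredT (fun k => grad_form Om (v k) (v k)) (fun k _ => g k).
  by apply.
have := poincare oOm OK (Hv j); rewrite /semi_norm g0 sqrtr0 mulr0 => h.
have ge0 : 0 <= ip Om (v j) (v j).
  apply: (semi_inner_ge0 ipS); exact/sobolev1_L2/H10_sobolev.
by apply/eqP; rewrite eq_le ge0 andbT -sqrtr_eq0 eq_le h sqrtr_ge0.
Qed.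

(** For each component, the density lemma applies to the flux made of the
    gradient of [psi i] with the pressure subtracted from its i-th entry. *)
Lemma stokes_test f psi theta w : vL2 Om f -> stokes_solution Om f psi theta ->
  vH10 Om w -> vgrad psi w - div_form w theta = vip f w.
Proof.
move=> Lf [Hpsi [Lt _] mom _] Hw.
rewrite /vgrad /div_form /vip -sumrB; apply: eq_bigr => i _.
have Lpsi j : L2 Om (wpd Om j (psi i)) by apply: (wpd_L2); exact: H10_sobolev.
pose G j : V -> R := if j == i then - 1 *: theta + wpd Om j (psi i) else wpd Om j (psi i).
have LG j : L2 Om (G j) by rewrite /G; case: ifP => _ //; exact: L2_lin.
have GE j q : L2 Om q -> ip Om (G j) q =
    ip Om (wpd Om j (psi i)) q - (if j == i then ip Om theta q else 0).
  move=> Lq; rewrite /G; case: ifP => _; last by rewrite subr0.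
  by rewrite (semi_inner_linl ipS)// mulN1r addrC.
have sumG (h : 'I_d -> V -> R) : (forall j, L2 Om (h j)) -> \sum_(j < d) ip Om (G j) (h j) =
    \sum_(j < d) ip Om (wpd Om j (psi i)) (h j) - ip Om theta (h i).
  move=> Lh; under eq_bigr do rewrite GE//; rewrite sumrB -big_mkcond /=.
  by rewrite big_pred1_eq.
have Lw j : L2 Om (wpd Om j (w i)) by apply: (wpd_L2); exact: H10_sobolev.
have mom' phi : test_function Om phi ->
    \sum_(j < d) ip Om (G j) (pderiv j phi) = ip Om (f i) phi.
  move=> tp; have Ldp j := test_function_L2 oOm (test_function_pderiv j tp).
  apply: eq_trans (sumG _ Ldp) _; apply: eq_trans (mom i phi tp).
  congr (_ - _); apply: esym.
  exact: (ip_sum oOm (u := fun j => wpd Om j (psi i)) (w := fun j => pderiv j phi)).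
apply: eq_trans (H10_density oOm LG (Lf i) mom' (Hw i)).
apply: eq_trans (esym (sumG _ Lw)).
by congr (_ - _); exact: ipC.
Qed.

Lemma div_form_stokes f psi theta q : stokes_solution Om f psi theta -> L2 Om q ->
  div_form psi q = 0.
Proof.
move=> [Hpsi _ _ div0] Lq; have Spsi := vH10_sobolev Hpsi.
rewrite -div_formE// -[RHS](_ : ip Om 0 q = 0); last first.
  have := semi_inner_linl ipS (- 1) (L2_0 oOm) (L2_0 oOm) Lq.
  by rewrite scaler0 addr0 mulN1r addNr.
have Ld : L2 Om (divergence Om psi).
  rewrite /divergence; elim: (index_enum _) => [|i s IH].
    by rewrite (_ : (fun _ => _) = 0); [exact: L2_0|apply/funext => x; rewrite big_nil].
  rewrite (_ : (fun _ => _) = 1 *: wpd Om i (psi i) +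
      (fun x => \sum_(j <- s) wpd Om j (psi j) x)).
    by apply: (L2_lin oOm) => //; exact: wpd_L2.
  by apply/funext => x; rewrite big_cons scale1r.
by apply: (ip_eq_on oOm) => //; exact: L2_0.
Qed.

End vector_fields.

(** * Stability and duality *)

Section discrete_stokes.
Variables (R : realType) (d : nat) (Om : set 'rV[R]_d).
Hypothesis oOm : open Om.
Local Notation mu := (lebesgue_rV R d).
Local Notation V := 'rV[R]_d.
Local Notation E := ('I_d -> V -> R).
Variables (X : set E) (M : set (V -> R)).
Hypothesis X_space : findim_subspace (veq Om) (vH10 Om) X.
Hypothesis M_space : findim_subspace (eq_on Om) (L2_mean0 Om `&` sobolev Om 1) M.
Variables (i0 : 'I_d) (K : R).
Hypothesis Om_bounded : Om `<=` cube K.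
Variable beta : R.
Hypotheses (beta0 : 0 < beta)
  (LBB : forall q, M q -> beta * Hnorm Om 0 q <= LBB_sup Om X q).

Local Notation a := (vgrad Om).
Local Notation b := (div_form Om).
Local Notation nrm := (semi_norm a).
Local Notation nrmp := (semi_norm (ip Om)).
Local Notation H10v := (vH10 Om).

Let aS := vgrad_H10 oOm.
Let ipS := ip_semi_inner oOm.
Let sob v : H10v v -> vsobolev Om 1 v := @vH10_sobolev R d Om v.

Lemma X_H10 v : X v -> H10v v.
Proof. by have [n [x [_ XP]]] := X_space; move=> /XP[]. Qed.

Lemma M_L2 q : M q -> L2 Om q.
Proof. by have [n [x [_ XP]]] := M_space; move=> /XP[[_ /sobolev1_L2]]. Qed.

Lemma X_sub u v : X u -> X v -> X (u - v).
Proof.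
have [n [x [Sx XP]]] := X_space; move=> /XP[Hu [cu eu]] /XP[Hv [cv ev]].
apply/XP; split; first exact: (lin_closed_sub (vH10_lin oOm)).
exists (fun i => cu i - cv i) => j.
have := ev j; have := eu j; apply: filterS2 => y + + Oy => /(_ Oy) e1 /(_ Oy) e2.
under eq_bigr do rewrite scalerBl.
by rewrite sumrB -[LHS]/(u j y - v j y) e1 e2.
Qed.

(** The quotients of the LBB condition have the H^1 norm as denominator, which
    dominates the norm of the gradient; an empty supremum is 0. *)
Lemma LBB_le p (C : R) : M p -> 0 <= C -> (forall w, X w -> b w p <= C * nrm w) ->
  beta * nrmp p <= C.
Proof.
move=> Mp C0 bC; have Lp := M_L2 Mp.
have -> : nrmp p = Hnorm Om 0 p by rewrite /Hnorm sqnorm0E.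
apply: le_trans (LBB Mp) _; rewrite /LBB_sup.
set A := [set _ | _ in _].
have AC : ubound A C.
  move=> _ [w [Xw _] <-].
  have Sw := sob (X_H10 Xw).
  rewrite div_formE//.
  have nw := vgrad_le_vHnorm1 oOm Sw.
  have w1 : 0 <= vHnorm Om 1 w := sqrtr_ge0 _.
  have [->|w0] := eqVneq (vHnorm Om 1 w) 0; first by rewrite invr0 mulr0.
  have {w0 w1}w0 : 0 < vHnorm Om 1 w by rewrite lt_def w0.
  rewrite ler_pdivrMr//; apply: le_trans (bC _ Xw) _.
  by rewrite ler_wpM2l.
have [->|/set0P A0] := eqVneq A set0; first by rewrite sup0.
exact: ge_sup.
Qed.

(** Testing with [u] itself kills the gradient of [u], hence [u]; the momentum
    equation then makes every quotient of the LBB condition for [p] vanish. *)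
Lemma discrete_unique u p : X u -> M p -> (forall w, X w -> a u w = b w p) ->
  (forall q, M q -> b u q = 0) -> veq Om u 0 /\ eq_on Om p 0.
Proof.
move=> Xu Mp mom div0; have Lp := M_L2 Mp; have Hu := X_H10 Xu.
have u0 : a u u = 0 by rewrite mom// div0.
split; first exact: (vgrad_eq0 oOm (fun x Ox => Om_bounded Ox i0)).
have bw w : X w -> b w p <= 0 * nrm w.
  move=> Xw; rewrite mul0r -mom//.
  have := cauchy_schwarz aS Hu (X_H10 Xw).
  by rewrite /semi_norm u0 sqrtr0 mul0r; apply: le_trans; exact: ler_norm.
apply: (ip_eq0 oOm Lp); apply/eqP.
rewrite eq_le (semi_inner_ge0 ipS)// andbT -sqrtr_eq0 eq_le sqrtr_ge0 andbT.
by have := LBB_le Mp (lexx _) bw; rewrite pmulr_rle0.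
Qed.

Definition is_stokes_projection (F : E -> E) (G : E -> V -> R) := forall v, H10v v ->
  [/\ X (F v), M (G v), forall w, X w -> a (F v) w - b w (G v) = a v w
    & forall q, M q -> b (F v) q = b v q].

Lemma L2_cst1 : L2 Om (fun=> 1).
Proof.
have mOm := open_measurable_rV oOm.
have H : mu.-integrable Om (EFin \o (fun=> 1)).
  apply: (@bounded_cube_integrable _ _ _ _ K 1) => // [x _|x /Om_bounded//].
  by rewrite normr1.
apply/L2P; split; first exact: measurable_cst.
by move: H; congr (_.-integrable _ _); apply/funext => x /=; rewrite expr1n.
Qed.

Lemma mean0_lin : lin_closed (L2_mean0 Om `&` sobolev Om 1).
Proof.
move=> k p q [[Lp p0] Sp] [[Lq q0] Sq]; split; last exact: sobolev1_lin.
split; first exact: L2_lin.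
have mE r : \int[mu]_(x in Om) r x = ip Om r (fun=> 1).
  by apply: eq_Rintegral => x _; rewrite mulr1.
move: p0 q0; rewrite !mE => p0 q0.
by rewrite (semi_inner_linl ipS) ?p0 ?q0 ?mulr0 ?addr0//; exact: L2_cst1.
Qed.

Lemma mean0_0 : (L2_mean0 Om `&` sobolev Om 1) 0.
Proof.
split; last by apply: (test_function_sobolev1 oOm); exact: test_function0.
split; first exact: L2_0.
by rewrite Rintegral_cst ?mul0r//; exact: open_measurable_rV.
Qed.

(** Variational equations can be checked on generators, although the elements of
    the space are combinations of them only up to equality almost everywhere. *)
Lemma findim_ext (T : lmodType R) (eqv : T -> T -> Prop) (S Y : set T) (f : T -> R)
    n (x : 'I_n -> T) : S 0 -> lin_closed S ->
  (forall i, S (x i)) ->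
  (forall v, Y v <-> S v /\ exists c : 'I_n -> R, eqv v (\sum_i c i *: x i)) ->
  (forall (k : R) u v, S u -> S v -> f (k *: u + v) = k * f u + f v) ->
  (forall u v, S u -> S v -> eqv u v -> f u = f v) ->
  (forall i, f (x i) = 0) -> forall w, Y w -> f w = 0.
Proof.
move=> S0 Sc Sx YP fl fe fx w /YP[Sw [c wc]].
have [Ss fs] := linear_on_sum S0 Sc fl c Sx.
by rewrite (fe _ _ Sw Ss wc) fs big1// => i _; rewrite fx mulr0.
Qed.

(** The saddle point system is solvable because its homogeneous solutions vanish
    almost everywhere, hence are invisible to the forms. *)
Lemma stokes_projection_exists : exists F G, [/\ is_stokes_projection F G,
  forall (k : R) v w, H10v v -> H10v w -> F (k *: v + w) = k *: F v + F w
  & forall v w, H10v v -> H10v w -> veq Om v w -> F v = F w].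
Proof.
have [n [x [Sx XP]]] := X_space; have [m [y [Sy MP]]] := M_space.
have Ly k : L2 Om (y k) by have [_ /sobolev1_L2] := Sy k.
have blinl (k : R) u v q : H10v u -> H10v v -> L2 Om q ->
    b (k *: u + v) q = k * b u q + b v q.
  by move=> Hu Hv Lq; apply: (div_form_linl oOm) => //; exact: sob.
have blinr (k : R) p q v : L2 Om p -> L2 Om q -> H10v v ->
    b v (k *: p + q) = k * b v p + b v q.
  by move=> Lp Lq Hv; apply: (div_form_linr oOm) => //; exact: sob.
have S0 := vH10_0 oOm; have L0 := L2_0 oOm; have Lc := L2_lin oOm.
pose F := saddle_fst a b x y; pose G := saddle_snd a b x y.
have sumX c : X (\sum_(i < n) c i *: x i).
  apply/XP; split; last by exists c; exact: veq_refl.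
  exact: (saddle_sum_in S0 aS Sx).
have sumM c : M (\sum_(i < m) c i *: y i).
  apply/MP; split; last by exists c; exact: eq_on_refl.
  exact: (saddle_sum_inQ mean0_0 mean0_lin Sy).
have extX u v p : H10v u -> H10v v -> L2 Om p ->
    (forall j, a u (x j) - b (x j) p = a v (x j)) ->
    forall w, X w -> a u w - b w p = a v w.
  move=> Hu Hv Lp h w Xw; pose f w := a u w - b w p - a v w.
  have fl (k : R) w1 w2 : H10v w1 -> H10v w2 -> f (k *: w1 + w2) = k * f w1 + f w2.
    move=> H1 H2; rewrite /f (semi_inner_linr aS k H1 H2 Hu).
    rewrite (semi_inner_linr aS k H1 H2 Hv) (blinl k _ _ _ H1 H2 Lp).
    by move: (a u w1) (a u w2) (b w1 p) (b w2 p) (a v w1) (a v w2) => *; ring.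
  have fe w1 w2 : H10v w1 -> H10v w2 -> veq Om w1 w2 -> f w1 = f w2.
    move=> H1 H2 e12.
    have av z : H10v z -> a z w1 = a z w2.
      move=> Hz; rewrite (semi_innerC aS z w1) (semi_innerC aS z w2).
      exact: (vgrad_eq oOm (sob H1) (sob H2) (sob Hz) e12).
    by rewrite /f (av _ Hu) (av _ Hv) (div_form_eq oOm (sob H1) (sob H2) Lp e12).
  have fx i : f (x i) = 0 by rewrite /f h subrr.
  have := findim_ext S0 (semi_inner_closed aS) Sx XP fl fe fx Xw.
  by rewrite /f => /eqP; rewrite subr_eq0 => /eqP.
have extM u v : H10v u -> H10v v -> (forall k, b u (y k) = b v (y k)) ->
    forall q, M q -> b u q = b v q.
  move=> Hu Hv h q Mq; pose f q := b u q - b v q.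
  have fl (k : R) p1 p2 : (L2_mean0 Om `&` sobolev Om 1) p1 ->
      (L2_mean0 Om `&` sobolev Om 1) p2 -> f (k *: p1 + p2) = k * f p1 + f p2.
    move=> [_ /sobolev1_L2 L1] [_ /sobolev1_L2 L2].
    rewrite /f (blinr k _ _ _ L1 L2 Hu) (blinr k _ _ _ L1 L2 Hv).
    by rewrite mulrBr opprD addrACA.
  have fe p1 p2 : (L2_mean0 Om `&` sobolev Om 1) p1 ->
      (L2_mean0 Om `&` sobolev Om 1) p2 -> eq_on Om p1 p2 -> f p1 = f p2.
    move=> [_ /sobolev1_L2 L1] [_ /sobolev1_L2 L2] e12.
    rewrite /f (div_form_eqr oOm (sob Hu) L1 L2 e12).
    by rewrite (div_form_eqr oOm (sob Hv) L1 L2 e12).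
  have fx i : f (y i) = 0 by rewrite /f h subrr.
  have := findim_ext mean0_0 mean0_lin Sy MP fl fe fx Mq.
  by rewrite /f => /eqP; rewrite subr_eq0 => /eqP.
have a0 w : H10v w -> a 0 w = 0.
  move=> Hw; have := semi_inner_linl aS (- 1) S0 S0 Hw.
  by rewrite scaler0 addr0 mulN1r addNr.
have b0l q : L2 Om q -> b 0 q = 0.
  move=> Lq; have := blinl (- 1) _ _ _ S0 S0 Lq.
  by rewrite scaler0 addr0 mulN1r addNr.
have b0r w : H10v w -> b w 0 = 0.
  move=> Hw; have := blinr (- 1) _ _ _ L0 L0 Hw.
  by rewrite scaler0 addr0 mulN1r addNr.
exists F, G; split.
- move=> v Hv.
  have [s1 s2] : (forall j, a (F v) (x j) - b (x j) (G v) = a v (x j)) /\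
      (forall k, b (F v) (y k) = b v (y k)).
    apply: (saddle_solution S0 aS L0 Lc blinl blinr Sx Ly Hv) => c q u p h1 h2.
    have Xu : X u := sumX c.
    have Mp : M p := sumM q.
    clearbody u p; have Hu := X_H10 Xu; have Lp := M_L2 Mp.
    have [||u0 p0] := discrete_unique Xu Mp.
    + move=> w Xw.
      have hx j : a u (x j) - b (x j) p = a 0 (x j).
        apply: etrans (esym (a0 _ (Sx j))).
        by apply/eqP; rewrite subr_eq0; apply/eqP; exact: h1.
      have /eqP := etrans (extX u 0 p Hu S0 Lp hx w Xw) (a0 _ (X_H10 Xw)).
      by rewrite subr_eq0 => /eqP.
    + move=> r Mr.
      have hy k : b u (y k) = b 0 (y k) := etrans (h2 k) (esym (b0l _ (Ly k))).
      exact: etrans (extM u 0 Hu S0 hy r Mr) (b0l _ (M_L2 Mr)).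
    apply: etrans (semi_innerC aS v u) _.
    apply: etrans (vgrad_eq oOm (sob Hu) (sob S0) (sob Hv) u0) _.
    apply: etrans (a0 v Hv) _; apply: esym.
    exact: etrans (div_form_eqr oOm (sob Hv) Lp L0 p0) (b0r v Hv).
  have XF : X (F v) := sumX _.
  have MG : M (G v) := sumM _.
  move: (F v) (G v) XF MG s1 s2 => Fv Gv XF MG s1 s2.
  split; [exact: XF|exact: MG| |].
    exact: (extX Fv v Gv (X_H10 XF) Hv (M_L2 MG) s1).
  exact: (extM Fv v (X_H10 XF) Hv s2).
- by move=> k v w Hv Hw; exact: (saddle_lin aS blinl Sx Ly).
- move=> v w Hv Hw vw; apply: saddle_ext => j.
    exact: (vgrad_eq oOm (sob Hv) (sob Hw) (sob (Sx j)) vw).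
  exact: (div_form_eq oOm (sob Hv) (sob Hw) (Ly j) vw).
Qed.

(** The difference of [F (F v)] and [F v], with the pressure [G (F v)], solves
    the homogeneous problem. *)
Lemma stokes_projection_idem F G v : is_stokes_projection F G -> H10v v ->
  veq Om (F (F v)) (F v).
Proof.
move=> FG Hv; have [XF MG mom div] := FG _ Hv.
have [XFF MGF momF divF] := FG _ (X_H10 XF).
have HF := X_H10 XF; have HFF := X_H10 XFF.
have XD : X (F (F v) - F v) by exact: X_sub.
have DE : F (F v) - F v = - 1 *: F v + F (F v) by rewrite scaleN1r addrC.
have m w : X w -> a (F (F v) - F v) w = b w (G (F v)).
  move=> Xw; rewrite DE (semi_inner_linl aS (- 1) HF HFF (X_H10 Xw)).
  have := momF _ Xw; move: (a _ w) (a _ w) (b w _) => A B C; lra.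
have c q : M q -> b (F (F v) - F v) q = 0.
  move=> Mq; rewrite DE (div_form_linl oOm (- 1) (sob HF) (sob HFF) (M_L2 Mq)).
  by have := divF _ Mq => ->; rewrite mulN1r addNr.
have [h _] := discrete_unique XD MGF m c.
move=> i; have := h i; apply: filterS => y + Oy => /(_ Oy) /eqP.
by rewrite -[X in X == _]/(F (F v) i y - F v i y) subr_eq0 => /eqP.
Qed.

Section estimates.
Variables (F : E -> E) (G : E -> V -> R) (v : E).
Hypotheses (FG : is_stokes_projection F G) (Hv : H10v v).
Local Notation u := (F v).
Local Notation p := (G v).
Local Notation e := (v - F v).

Let Hu : H10v u. Proof. by have [/X_H10] := FG Hv. Qed.
Let Lp : L2 Om p. Proof. by have [_ /M_L2] := FG Hv. Qed.
Let eE : e = - 1 *: u + v. Proof. by rewrite scaleN1r addrC. Qed.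
Let He : H10v e. Proof. by rewrite eE; exact: vH10_lin. Qed.

Let kappa := d%:R / beta.
Let kappa0 : 0 <= kappa. Proof. by rewrite divr_ge0// ltW. Qed.

Let err_mom w : X w -> a e w = - b w p.
Proof.
move=> Xw; have [_ _ mom _] := FG Hv; have Hw := X_H10 Xw.
by rewrite eE (semi_inner_linl aS)// -(mom _ Xw) mulN1r addrA addNr add0r.
Qed.

Lemma projection_err_div q : M q -> b e q = 0.
Proof.
move=> Mq; have [_ _ _ div] := FG Hv.
rewrite eE (div_form_linl oOm)//; [|exact: sob|exact: sob|exact: M_L2].
by rewrite div// mulN1r addNr.
Qed.

Lemma pressure_le : beta * nrmp p <= nrm e.
Proof.
have [_ Mp _ _] := FG Hv.
apply: LBB_le => //; first exact: semi_norm_ge0.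
move=> w Xw; have Hw := X_H10 Xw.
have -> : b w p = - a e w by rewrite err_mom// opprK.
by apply: le_trans (ler_norm _) _; rewrite normrN; exact: (cauchy_schwarz aS).
Qed.

Let err_le : nrm e <= nrm u + nrm v.
Proof.
by have := semi_norm_triangle aS (- 1) Hu Hv; rewrite normrN1 mul1r -eE.
Qed.

(** Testing the discrete momentum equation with [F v] gives
    U ^ 2 <= V * U + kappa * V * (U + V) for the norms U and V of the gradients of
    [F v] and [v]. *)
Lemma projection_le : nrm u <= (1 + 2 * kappa) * nrm v.
Proof.
have [Xu Mp mom div] := FG Hv.
have U0 := semi_norm_ge0 a u; have V0 := semi_norm_ge0 a v.
have h1 : nrm u ^+ 2 <= nrm v * nrm u + d%:R * nrm v * nrmp p.
  have e : a u u = a v u + b v p.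
    by apply/eqP; rewrite -subr_eq -(div _ Mp); apply/eqP; exact: (mom _ Xu).
  apply: le_trans (_ : a v u + b v p <= _).
    by rewrite -e (semi_norm_sqr aS Hu).
  apply: lerD; apply: le_trans (ler_norm _) _; first exact: (cauchy_schwarz aS Hv Hu).
  exact: (div_form_le oOm (sob Hv) Lp).
have h2 : d%:R * nrm v * nrmp p <= kappa * nrm v * (nrm u + nrm v).
  rewrite /kappa -!mulrA ler_wpM2l// mulrCA ler_wpM2l//.
  by rewrite mulrC ler_pdivlMr// mulrC; exact: le_trans pressure_le err_le.
move: h1 h2 kappa0 U0 V0.
move: (nrm u) (nrm v) (d%:R * nrm v * nrmp p) kappa => U W P k h1 h2 k0 U0 W0.
have [UW|WU] := leP U W; first nra.
have Upos : 0 < U by lra.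
have h3 : 0 <= k * W * (U - W) by rewrite !mulr_ge0// subr_ge0 ltW.
rewrite -(ler_pM2r Upos); move: h1 h2 h3; rewrite expr2; lra.
Qed.

Lemma projection_err_le : nrm e <= (2 + 2 * kappa) * nrm v.
Proof.
apply: le_trans err_le _; apply: le_trans (lerD projection_le (lexx _)) _.
by rewrite -[X in _ + X]mul1r -mulrDl; apply: ler_wpM2r; [exact: semi_norm_ge0|lra].
Qed.

Lemma projection_pressure_le : nrmp p <= (2 + 2 * kappa) * nrm v / beta.
Proof.
by rewrite ler_pdivlMr// mulrC; exact: le_trans pressure_le projection_err_le.
Qed.

(** The Stokes problem with the error as right-hand side is tested with the
    error.  The error is orthogonal to [wh] up to the pressure [G v], against
    which [psi] is invisible since it is divergence-free, and its divergence is
    orthogonal to [qh]. *)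
Lemma projection_duality psi theta wh qh : stokes_solution Om e psi theta ->
  X wh -> M qh ->
  vip Om e e <= nrm (psi - wh) * nrm e + d%:R * nrm (psi - wh) * nrmp p +
    d%:R * nrm e * nrmp (theta - qh).
Proof.
move=> sol Xw Mq.
have [Hpsi [Lt _] _ _] := sol; have Hw := X_H10 Xw; have Lq := M_L2 Mq.
have Le := vsobolev1_L2 (sob He).
have pE : psi - wh = - 1 *: wh + psi by rewrite scaleN1r addrC.
have tE : theta - qh = - 1 *: qh + theta by rewrite scaleN1r addrC.
have Hpw : H10v (psi - wh) by rewrite pE; exact: vH10_lin.
have Ltq : L2 Om (theta - qh) by rewrite tE; exact: L2_lin.
have e1 : a psi e = a (psi - wh) e + b (psi - wh) p.
  rewrite pE (semi_inner_linl aS)// (div_form_linl oOm)//; [|exact: sob|exact: sob].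
  rewrite (div_form_stokes oOm sol Lp) (semi_innerC aS wh e) err_mom//.
  by rewrite !mulN1r opprK addr0 addrAC subrr add0r.
have e2 : b e theta = b e (theta - qh).
  rewrite tE (div_form_linr oOm)//; last exact: sob.
  by rewrite (projection_err_div Mq) mulr0 add0r.
have -> : vip Om e e = a (psi - wh) e + b (psi - wh) p - b e (theta - qh).
  by rewrite -e1 -e2; exact/esym/(stokes_test oOm).
apply: lerD; [apply: lerD|].
- by apply: le_trans (ler_norm _) _; exact: (cauchy_schwarz aS).
- by apply: le_trans (ler_norm _) _; apply: (div_form_le oOm) => //; exact: sob.
- by apply: le_trans (ler_norm _) _; rewrite normrN; apply: (div_form_le oOm) => //; exact: sob.
Qed.

End estimates.

End discrete_stokes.

(** * The theorem *)

(** The interpolation errors [P] and [T] carry a factor [Err], which cancels one of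
    the two factors on the left of the duality estimate. *)
Lemma duality_arith (R : realType) (Err V P N Q T h c1 c2 cr k beta D : R) :
  0 <= Err -> 0 <= V -> 0 <= P -> 0 <= N -> 0 <= D -> 0 < h -> 0 < beta -> 0 <= k ->
  0 <= c1 -> 0 <= c2 -> 0 <= cr -> 0 <= Q -> 0 <= T ->
  P <= c1 * h * (cr * Err) -> T <= c2 * h * (cr * Err) ->
  N <= k * V -> Q <= k * V / beta ->
  Err ^+ 2 <= P * N + D * P * Q + D * N * T ->
  Err <= cr * (c1 * k + D * c1 * (k / beta) + D * k * c2) * h * V.
Proof.
move=> E0 V0 P0 N0 D0 h0 b0 k0 c10 c20 cr0 Q0 T0 hP hT hN hQ hE.
have [->|En0] := eqVneq Err 0.
  rewrite mulr_ge0// mulr_ge0 ?(ltW h0)// mulr_ge0// !addr_ge0 ?mulr_ge0//.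
  by rewrite invr_ge0 ltW.
have Epos : 0 < Err by rewrite lt_def En0.
have kb0 : 0 <= k / beta by apply: divr_ge0 => //; exact: ltW.
rewrite -(ler_pM2r Epos) -expr2; apply: le_trans hE _.
have h1 : P * N <= (c1 * h * (cr * Err)) * (k * V) by apply: ler_pM.
have h2 : D * P * Q <= D * (c1 * h * (cr * Err)) * (k * V / beta).
  by apply: ler_pM => //; [exact: mulr_ge0|exact: ler_wpM2l].
have h3 : D * N * T <= D * (k * V) * (c2 * h * (cr * Err)).
  by apply: ler_pM => //; [exact: mulr_ge0|exact: ler_wpM2l].
apply: le_trans (lerD (lerD h1 h2) h3) _.
by rewrite le_eqVlt; apply/orP; left; apply/eqP; ring.
Qed.

Theorem theorem4p1 (R : realType) (d : nat) (d23 : d = 2%N \/ d = 3%N)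
  (Om : set 'rV[R]_d) (Om_lip : lipschitz_domain Om)
  (Hs : set R) (Th : R -> seq 'M[R]_(d.+1, d))
  (Th_mesh : triangulation_family Om Hs Th)
  (X : R -> set (vfield R d)) (M : R -> set ('rV[R]_d -> R))
  (X_space : forall h, Hs h -> findim_subspace (veq Om) (vH10 Om) (X h))
  (M_space : forall h, Hs h ->
     findim_subspace (eq_on Om) (L2_mean0 Om `&` sobolev Om 1) (M h))
  (X_inverse : exists c : R, forall h v, Hs h -> X h v ->
     vHnorm Om 1 v <= c * h^-1 * vHnorm Om 0 v)
  (M_inverse : exists c : R, forall h q, Hs h -> M h q ->
     Hnorm Om 1 q <= c * h^-1 * Hnorm Om 0 q)
  (scott_zhang_X : exists c : R, forall h, Hs h ->
     exists C : vfield R d -> vfield R d,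
     [/\ operator_on (veq Om) (vH10 Om) (X h) C,
         forall v, vH10 Om v ->
           vHnorm Om 0 (v - C v) + h * vHnorm Om 1 (C v)
             <= c * h * vHnorm Om 1 v
       & forall v, vH10 Om v -> vsobolev Om 2 v ->
           vHnorm Om 1 (v - C v) <= c * h * vHnorm Om 2 v])
  (scott_zhang_M : exists c : R, forall h, Hs h ->
     exists I : ('rV[R]_d -> R) -> ('rV[R]_d -> R),
     operator_on (eq_on Om) (L2_mean0 Om) (M h) I /\
     forall q, L2_mean0 Om q -> sobolev Om 1 q ->
       Hnorm Om 0 (q - I q) + h * Hnorm Om 1 (I q) <= c * h * Hnorm Om 1 q)
  (regularity : stokes_regularity Om)
  (LBB : exists2 c : R, 0 < c & forall h q, Hs h -> M h q ->
     c * Hnorm Om 0 q <= LBB_sup Om (X h) q) :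
  exists c' : R, forall h, Hs h ->
    exists F : vfield R d -> vfield R d,
      fortin_projection Om (X h) (M h) F /\
      forall v, vH10 Om v ->
        vHnorm Om 0 (v - F v) <= c' * h * vHnorm Om 1 v.
Proof.
have [oOm _ _ bOm _] := Om_lip.
have [K OK] : exists K, Om `<=` cube K.
  have [B [_ BP]] := bOm; exists (B + 1) => x Ox i.
  by apply: le_trans (cube_norm x i) _; apply: BP => //; rewrite ltrDl.
have d0 : (0 < d)%N by case: d23 => ->.
have [c1 SX] := scott_zhang_X; have [c2 SM] := scott_zhang_M.
have [cr reg] := regularity; have [beta beta0 infsup] := LBB.
(* The stability constant of the projection for the gradient of the error. *)
pose k : R := 2 + 2 * (d%:R / beta).
have k0 : 0 <= k by rewrite addr_ge0// mulr_ge0// divr_ge0// ltW.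
exists (`|cr| * (`|c1| * k + d%:R * `|c1| * (k / beta) + d%:R * k * `|c2|)) => h Hh.
have [h0 _ _] : [/\ 0 < h, conforming_triangulation Om (Th h) & mesh_size (Th h) h].
  by have [+ _ _] := Th_mesh; exact.
have infh q : M h q -> beta * Hnorm Om 0 q <= LBB_sup Om (X h) q by exact: infsup.
have Xh := X_space _ Hh; have Mh := M_space _ Hh.
have [F [G [FG Flin Fext]]] :=
  stokes_projection_exists oOm Xh Mh (Ordinal d0) OK beta0 infh.
exists F; split.
  split.
  - split; first split.
    + by move=> v Hv; have [] := FG _ Hv.
    + by move=> v w Hv Hw vw; rewrite (Fext _ _ Hv Hw vw); exact: veq_refl.
    + by move=> t v w Hv Hw; rewrite (Flin t _ _ Hv Hw); exact: veq_refl.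
  - move=> v Hv.
    exact: (stokes_projection_idem oOm Xh Mh (Ordinal d0) OK beta0 infh FG Hv).
  - move=> v q Hv Mq.
    have [XF _ _ _] := FG _ Hv; have HF := X_H10 Xh XF.
    have He : vH10 Om (v - F v) by exact: (lin_closed_sub (vH10_lin oOm) Hv HF).
    apply: etrans (div_formE oOm (vH10_sobolev He) (M_L2 Mh Mq)) _.
    exact: (projection_err_div oOm Xh Mh FG Hv Mq).
move=> v Hv.
have [XF _ _ _] := FG _ Hv; have HF := X_H10 Xh XF.
have He : vH10 Om (v - F v) by exact: (lin_closed_sub (vH10_lin oOm) Hv HF).
have Le := vsobolev1_L2 (vH10_sobolev He).
have [[psi [theta sol]] /(_ psi theta sol)[Spsi Stheta est]] := reg _ Le.
have [Hpsi Ltheta _ _] := sol.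
have [C [[CX _] _ Cest]] := SX _ Hh; have [I [[IM _] Iest]] := SM _ Hh.
have Epsi := Cest _ Hpsi Spsi; have Eth := Iest _ Ltheta Stheta.
have XC := CX _ Hpsi; have MI := IM _ Ltheta.
have nn2 : 0 <= vHnorm Om 2 psi := sqrtr_ge0 _.
have nn1 : 0 <= Hnorm Om 1 theta := sqrtr_ge0 _.
have nnE : 0 <= vHnorm Om 0 (v - F v) := sqrtr_ge0 _.
have cE : cr * vHnorm Om 0 (v - F v) <= `|cr| * vHnorm Om 0 (v - F v).
  by apply: ler_wpM2r nnE _ _ (ler_norm cr).
have crE2 : vHnorm Om 2 psi <= `|cr| * vHnorm Om 0 (v - F v).
  by apply: le_trans (le_trans est cE); rewrite lerDl.
have crE1 : Hnorm Om 1 theta <= `|cr| * vHnorm Om 0 (v - F v).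
  by apply: le_trans (le_trans est cE); rewrite lerDr.
have bound (c y : R) : 0 <= y -> y <= `|cr| * vHnorm Om 0 (v - F v) ->
    c * h * y <= `|c| * h * (`|cr| * vHnorm Om 0 (v - F v)).
  move=> y0 yE; have ch0 : 0 <= `|c| * h by rewrite mulr_ge0 ?(ltW h0).
  apply: le_trans (ler_wpM2l ch0 yE).
  by apply: ler_wpM2r y0 _ _ _; apply: ler_wpM2r (ltW h0) _ _ (ler_norm c).
have V1 : k * semi_norm (vgrad Om) v <= k * vHnorm Om 1 v.
  by apply: ler_wpM2l k0 _ _ (vgrad_le_vHnorm1 oOm (vH10_sobolev Hv)).
have dual := projection_duality oOm Xh Mh FG Hv sol XC MI.
have Hpc : vH10 Om (psi - C psi).
  exact: (lin_closed_sub (vH10_lin oOm) Hpsi (X_H10 Xh XC)).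
apply: (duality_arith nnE (sqrtr_ge0 _) (semi_norm_ge0 (vgrad Om) (psi - C psi))
  (semi_norm_ge0 (vgrad Om) (v - F v)) (ler0n R d) h0 beta0 k0
  (normr_ge0 c1) (normr_ge0 c2) (normr_ge0 cr)
  (semi_norm_ge0 (ip Om) (G v)) (semi_norm_ge0 (ip Om) (theta - I theta))).
- apply: le_trans (vgrad_le_vHnorm1 oOm (vH10_sobolev Hpc)) _.
  apply: le_trans Epsi _; apply: bound crE2; exact: nn2.
- apply: le_trans (bound c2 _ nn1 crE1); apply: le_trans Eth.
  have -> : semi_norm (ip Om) (theta - I theta) = Hnorm Om 0 (theta - I theta).
    by rewrite /Hnorm sqnorm0E.
  have nI : 0 <= h * Hnorm Om 1 (I theta) := mulr_ge0 (ltW h0) (sqrtr_ge0 _).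
  exact: (ler_wpDr nI (lexx _)).
- apply: le_trans V1.
  exact: (projection_err_le oOm Xh Mh beta0 infh FG Hv).
- apply: le_trans (projection_pressure_le oOm Xh Mh beta0 infh FG Hv) _.
  by apply: ler_wpM2r V1; rewrite invr_ge0 ltW.
- apply: le_trans dual; rewrite vHnorm0E.
  by rewrite (semi_norm_sqr (vip_semi_inner oOm) Le).
Qed.
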